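(* Assume that the function $\ell$ defined by $\ell(x)=\vec{\nu}(1/x)$ is in $\Pi_a$, where the slowly varying function $a$ tends to infinity at infinity, and let $v_n=12a(n)/n^2$. Then: 1. $\operatorname{Var}(M_{n,0})\sim\frac{3a(n)}{4n^2}$ as $n\to\infty$, and thus $v_n\asymp\operatorname{Var}(M_{n,0})$. 2. There exists $n_0\in\mathbb{N}$, depending on $\vec{\nu}$, such that for all $n>n_0$ and all $0<\lambda<n$, $$\log\mathbb{E}\left[e^{\lambda(M_{n,0}-\mathbb{E}M_{n,0})}\right]\le\frac{v_n\lambda^2}{2(1-\lambda/n)}.$$ The same results hold for $M_0(t)$: with $v_t=12a(t)/t^2$, $\operatorname{Var}(M_0(t))\sim\frac{3a(t)}{4t^2}$ as $t\to\infty$ (thus $v_t\asymp\operatorname{Var}(M_0(t))$), and there exists $t_0$ such that for all $t>t_0$ and all $0<\lambda<t$, $\log\mathbb{E}[e^{\lambda(M_0(t)-\mathbb{E}M_0(t))}]\le\frac{v_t\lambda^2}{2(1-\lambda/t)}$.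
   Context: Let $(p_j)_{j\ge1}$ be a probability mass function on the positive integers, and let $U_1,U_2,\dots$ be i.i.d. with $\mathbb{P}(U_i=j)=p_j$. For sample size $n$, $X_{n,j}=\sum_{i=1}^n \mathbb{I}_{\{U_i=j\}}$ and the missing mass is $M_{n,0}=\sum_{j\ge1}p_j\mathbb{I}_{\{X_{n,j}=0\}}$. In the Poisson setting, $N(t)$ is Poisson with mean $t$, independent of $(U_i)$, $X_j(t)=\sum_{i=1}^{N(t)}\mathbb{I}_{\{U_i=j\}}$ and $M_0(t)=\sum_{j\ge1}p_j\mathbb{I}_{\{X_j(t)=0\}}$. Counting function: $\vec{\nu}(x)=|\{j\ge1: p_j\ge x\}|$ for $x>0$. A measurable function $\ell:\mathbb{R}^+\to\mathbb{R}^+$ has the extended slow variation property with auxiliary function $a$, written $\ell\in\Pi_a$, if $a:\mathbb{R}^+\to\mathbb{R}^+$ is measurable and for all $x>0$, $\lim_{\tau\to\infty}\frac{\ell(\tau x)-\ell(\tau)}{a(\tau)}=\log x$. A function $a$ is slowly varying if $\lim_{\tau\to\infty}a(\tau x)/a(\tau)=1$ for all $x>0$. The notation $u_n\asymp w_n$ means that $u_n/w_n$ is bounded above and bounded away from $0$ for large $n$. *)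

(* Defs.v *)
From mathcomp Require Import all_boot all_order all_algebra.
From mathcomp Require Import finmap.
From mathcomp Require Import all_classical all_reals all_analysis.

Set Implicit Arguments.
Unset Strict Implicit.
Unset Printing Implicit Defensive.

Import Order.TTheory GRing.Theory Num.Theory.
Import numFieldNormedType.Exports.

Local Open Scope classical_set_scope.
Local Open Scope ring_scope.

(* Symbols and draws are numbered from 0: the symbol j : nat stands for the
   positive integer j.+1, and U 0, ..., U n.-1 is a sample of size n. *)

Definition is_pmf (R : realType) (p : nat -> R) : Prop :=
  (forall j, 0 <= p j) /\ (\sum_(0 <= j <oo) (p j)%:E = 1)%E.

Definition nu (R : realType) (p : nat -> R) (x : R) : \bar R :=
  counting [set j | x <= p j].

(* nu p y is finite for y > 0 when p is a pmf, so fine loses nothing at x > 0. *)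
Definition ell (R : realType) (p : nat -> R) (x : R) : R := fine (nu p x^-1).

Definition pos_measurable (R : realType) (f : R -> R) : Prop :=
  measurable_fun [set x : R | 0 < x] f /\ (forall x, 0 < x -> 0 <= f x).

Definition ext_slow_variation (R : realType) (l a : R -> R) : Prop :=
  [/\ pos_measurable l, pos_measurable a &
      forall x : R, 0 < x ->
        (l (tau * x) - l tau) / a tau @[tau --> +oo] --> ln x].

Definition slowly_varying (R : realType) (a : R -> R) : Prop :=
  forall x : R, 0 < x -> a (tau * x) / a tau @[tau --> +oo] --> (1 : R).

Definition asymp_equiv (R : realType) (T : Type) (F : set_system T)
    (u w : T -> R) : Prop :=
  u x / w x @[x --> F] --> (1 : R).

(* u and w are of the same order along the filter F; since y / 0 = 0, the lower
   bound forces w x != 0 eventually. *)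
Definition asymp_order (R : realType) (T : Type) (F : set_system T)
    (u w : T -> R) : Prop :=
  exists c C : R, 0 < c /\ \forall x \near F, c <= u x / w x <= C.

Definition mutually_independent d d' (T : measurableType d)
    (T' : measurableType d') (R : realType) (P : probability T R)
    (X : nat -> {RV P >-> T'}) : Prop :=
  forall (I : {fset nat}) (B : nat -> set T'), (forall i, measurable (B i)) ->
    P (\bigcap_(i in [set` I]) X i @^-1` B i) =
    (\prod_(i <- I) P (X i @^-1` B i))%E.

Definition iid_sample d (T : measurableType d) (R : realType)
    (P : probability T R) (p : nat -> R) (U : nat -> {RV P >-> nat}) : Prop :=
  mutually_independent U /\
  (forall i j, P (U i @^-1` [set j]) = (p j)%:E).

Definition sigma_of_seq d d' (T : measurableType d) (T' : measurableType d')
    (R : realType) (P : probability T R) (X : nat -> {RV P >-> T'}) :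
    set_system T :=
  <<s \bigcup_i preimage_set_system setT (X i) measurable >>.

Definition independent_of_seq d d' d'' (T : measurableType d)
    (T' : measurableType d') (T'' : measurableType d'') (R : realType)
    (P : probability T R) (Y : {RV P >-> T''}) (X : nat -> {RV P >-> T'}) :
    Prop :=
  forall (A : set T'') (E : set T), measurable A -> sigma_of_seq X E ->
    P (Y @^-1` A `&` E) = (P (Y @^-1` A) * P E)%E.

Definition poisson_sizes d (T : measurableType d) (R : realType)
    (P : probability T R) (U : nat -> {RV P >-> nat})
    (N : R -> {RV P >-> nat}) : Prop :=
  forall t : R, 0 < t ->
    (forall k : nat, P (N t @^-1` [set k]) = (poisson_pmf t k)%:E) /\
    independent_of_seq (N t) U.

Definition occupancy (T : Type) (U : nat -> T -> nat) (n j : nat) (w : T) :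
    nat := (\sum_(i < n) (U i w == j))%N.

Definition missing_mass (R : realType) (T : Type) (p : nat -> R)
    (U : nat -> T -> nat) (n : nat) (w : T) : R :=
  fine (\sum_(0 <= j <oo) (p j * (occupancy U n j w == 0%N)%:R)%:E)%E.

Definition poisson_missing_mass (R : realType) (T : Type) (p : nat -> R)
    (U : nat -> T -> nat) (N : R -> T -> nat) (t : R) (w : T) : R :=
  missing_mass p U (N t w) w.

Definition log_mgf d (T : measurableType d) (R : realType)
    (P : probability T R) (X : T -> R) (lambda : R) : \bar R :=
  lne ('E_P[fun w => expR (lambda * (X w - fine 'E_P[X]))])%E.

Definition var_factor (R : realType) (a : R -> R) (t : R) : R :=
  12 * a t / t ^+ 2.

(* Main.v *)
Require Import Defs.
From mathcomp Require Import all_boot all_order all_algebra.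
From mathcomp Require Import all_classical all_reals all_analysis.
From mathcomp Require Import measurable_realfun finmap ring lra.

Import Order.TTheory GRing.Theory Num.Theory.
Import numFieldNormedType.Exports.

Local Open Scope classical_set_scope.
Local Open Scope ring_scope.

(** In both models the symbols of a finite set J are all unseen with probability
    q(p(J)), where q(x) = (1-x)^n for the sample of size n and q(x) = e^{-tx} for
    the Poisson sample, and q(p(J)) is at most the product of the q(p_j), j in J.
    Writing e^{lambda p_j 1_j} = 1 + (e^{lambda p_j} - 1) 1_j and expanding the
    product over j as a sum over sets J, this inequality replaces negative
    association: the log-Laplace transform of the centred missing mass is at most
    the sum over j of e^{-t p_j} (e^{lambda p_j} - 1 - lambda p_j).  With
    s = lambda/t each term is at most s^2/(1-s) h(t p_j), where h(y) = y/2 for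
    y < 1 and h(y) = 3/y for y >= 1, and counting the p_j in dyadic cells, with
    l(2x) - l(x) ~ a(x) log 2, bounds the sum of the h(t p_j) by 6 a(t).

    For the variance, Riemann sums on a logarithmic grid show that the sum of the
    f(t p_j), with f(y) = y^2 e^{-y}, is equivalent to a(t) times the integral of
    f(y)/y over the half-line, which is 1.  The Poisson variance is
    t^{-2} times the sum of f(t p_j) - f(2 t p_j)/4, whence the factor
    1 - 1/4 = 3/4; the covariances of the binomial model only contribute
    O(a(n)^2/n^3), which is negligible because a(n)/n tends to 0. *)

Set Implicit Arguments.
Unset Strict Implicit.
Unset Printing Implicit Defensive.

(** * Calculus *)

Section calculus.
Variable R : realType.
Implicit Types s y u d : R.

(** The constants 1/2 and 3 are such that [mgf_term_le] holds; the decay towards 0 and towards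
    infinity makes the bounds on dyadic cells geometric. *)
Definition envelope (y : R) : R := if y < 1 then y / 2 else 3 / y.
Definition bell (y : R) : R := y ^+ 2 * expR (- y).
(* y |-> - gtail (e^y) is a primitive of y |-> bell (e^y). *)
Definition gtail (y : R) : R := (1 + y) * expR (- y).

Lemma envelope_ge0 y : 0 <= y -> 0 <= envelope y.
Proof. by rewrite /envelope; case: ifP => _ y0; rewrite divr_ge0. Qed.

Lemma powM_expRN_le n y : 0 <= y -> y ^+ n * expR (- y) <= n`!%:R.
Proof.
move=> y0; case: n => [|n].
  by rewrite expr0 mul1r fact0 -expR0 ler_expR oppr_le0.
rewrite expRN ler_pdivrMr ?expR_gt0// -ler_pdivrMl ?ltr0n ?fact_gt0//.
by have := @expR_ge1Dxn R y n y0; rewrite [X in _ + X <= _]mulrC; lra.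
Qed.

Lemma expRN_le1 y : 0 <= y -> expR (- y) <= 1.
Proof. by move=> y0; rewrite -expR0 ler_expR oppr_le0. Qed.

Lemma is_derive_gtail y : is_derive y 1 gtail (- (y * expR (- y))).
Proof.
rewrite /gtail; apply: is_derive_eq; rewrite /GRing.scale/=; ring.
Qed.

Lemma MVT_le (F dF : R -> R) (b c : R) : (forall x : R, is_derive x 1 F (dF x)) ->
  b <= c -> exists2 x, b <= x <= c & F c - F b = dF x * (c - b).
Proof.
move=> dFE bc; have [|x + ->] := MVT_segment bc (fun x _ => dFE x).
  apply/continuous_subspaceT => x; apply: differentiable_continuous.
  by have [/derivable1_diffP] := dFE x.
by rewrite in_itv/= => ?; exists x.
Qed.

(** After multiplication by e^{-u} the claim reads 1 <= (1 + u) e^{-u} + u^2/2, whose right side is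
    1 at 0 and has derivative u (1 - e^{-u}) >= 0. *)
Lemma expR_taylor1_le u : 0 <= u -> expR u - 1 - u <= u ^+ 2 / 2 * expR u.
Proof.
move=> u0; suff: 1 <= gtail u + u ^+ 2 / 2.
  rewrite /gtail expRN => /(ler_wpM2r (expR_ge0 u)).
  by rewrite mulrDl mulfVK ?gt_eqF ?expR_gt0//; lra.
pose F x := gtail x + x ^+ 2 / 2.
have dF (x : R) : is_derive x 1 F (x * (1 - expR (- x))).
  have := is_derive_gtail x => ?.
  rewrite /F; apply: is_derive_eq; rewrite /GRing.scale/=; by field.
rewrite -subr_ge0 (_ : _ - 1 = F u - F 0); last first.
  by rewrite /F /gtail oppr0 expR0; ring.
have [x /andP[x0 _] ->] := MVT_le dF u0.
by rewrite subr0 !mulr_ge0// subr_ge0 expRN_le1.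
Qed.

Lemma expR_ge_taylor2 u : 0 <= u -> 1 + u + u ^+ 2 / 2 <= expR u.
Proof.
move=> u0; pose F (x : R) := expR x - x - x ^+ 2 / 2.
have dF (x : R) : is_derive x 1 F (expR x - 1 - x).
  by rewrite /F; apply: is_derive_eq; rewrite /GRing.scale/=; field.
have [x _] := MVT_le dF u0.
have : 0 <= (expR x - 1 - x) * (u - 0).
  by rewrite subr0 mulr_ge0//; have := expR_ge1Dx x; lra.
by rewrite /F expR0; lra.
Qed.

(** The threshold 18 gives z^3 e^{-z} <= 27 / e^3 <= 3/2 in [mgf_term_le]. It is reached by raising
    e^{1/2} >= 13/8 to the sixth power. *)
Lemma expR3_ge18 : 18 <= expR 3 :> R.
Proof.
have e1 : 13 / 8 <= expR (1 / 2) :> R.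
  by apply: le_trans (expR_ge_taylor2 _); lra.
rewrite (_ : 3 = 3%:R * (2%:R * (1 / 2))); last by field.
rewrite 2!expRM_natl; move: (expR _) e1 => e e1.
have : 264 / 100 <= e ^+ 2 by nra.
by move: (e ^+ 2) => w w1; rewrite !exprS; nra.
Qed.

(** With z = (1 - s) y, the Taylor remainder gives [bd1], which has the factor s^2, and discarding -
    1 - s y gives [bd2], which has no power of y. The second is used only for y >= 1 and s >= 1/2,
    where s^2 is bounded below. *)
Lemma mgf_term_le s y : 0 < s < 1 -> 0 <= y ->
  expR (- y) * (expR (s * y) - 1 - s * y) <= s ^+ 2 / (1 - s) * envelope y.
Proof.
move=> /andP[s0 s1] y0; have q0 : 0 < 1 - s by rewrite subr_gt0.
rewrite mulrAC ler_pdivlMr//.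
have sy0 : 0 <= s * y by rewrite mulr_ge0// ltW.
set z := (1 - s) * y; have z0 : 0 <= z by rewrite mulr_ge0// ltW.
have eE : expR (- y) * expR (s * y) = expR (- z).
  by rewrite -expRD; congr expR; rewrite /z; ring.
have bd1 : expR (- y) * (expR (s * y) - 1 - s * y) * (1 - s)
    <= s ^+ 2 * (y * z / 2 * expR (- z)).
  apply: (@le_trans _ _ (expR (- y) * ((s * y) ^+ 2 / 2 * expR (s * y)) * (1 - s))).
    by rewrite ler_wpM2r// ?(ltW q0)// ler_wpM2l ?expR_ge0// expR_taylor1_le.
  by rewrite le_eqVlt -eE; apply/orP; left; apply/eqP; rewrite /z; field.
have bd2 : expR (- y) * (expR (s * y) - 1 - s * y) * (1 - s)
    <= (1 - s) * expR (- z).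
  rewrite mulrC ler_pM2l// -eE ler_wpM2l ?expR_ge0//; lra.
rewrite /envelope; case: ifPn => [y1|]; last rewrite -leNgt => y1.
  apply: (le_trans bd1); rewrite ler_wpM2l ?exprn_ge0 ?(ltW s0)//.
  have z1 : z <= 1 by rewrite /z; nra.
  by rewrite -[leRHS]mulr1 ler_pM ?expR_ge0 ?expRN_le1//; nra.
have y0' : 0 < y by lra.
rewrite mulrA ler_pdivlMr//.
have [s2|s2] := leP (1 / 2) s.
  apply: (@le_trans _ _ (z * expR (- z))).
    rewrite (_ : z * _ = (1 - s) * expR (- z) * y); last by rewrite /z; ring.
    by rewrite ler_wpM2r.
  (* This suffices because 3/4 <= 3 s^2 when s >= 1/2. *)
  have : z * expR (- z) <= 3 / 4.
    rewrite expRN ler_pdivrMr ?expR_gt0//.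
    by have := expR_ge_taylor2 z0; nra.
  by nra.
suff : z ^+ 3 * expR (- z) <= 6 * (1 - s) ^+ 2.
  move=> H; apply: (@le_trans _ _ (s ^+ 2 * (y * z / 2 * expR (- z)) * y)).
    by rewrite ler_wpM2r.
  rewrite -[leLHS]mulrA ler_wpM2l ?exprn_ge0 ?(ltW s0)//.
  rewrite -(ler_pM2r (exprn_gt0 2 q0)).
  by rewrite (_ : _ * _ = z ^+ 3 * expR (- z) / 2); [lra|by rewrite /z; field].
(* In this case s < 1/2, so that 6 (1 - s)^2 exceeds 3/2. *)
have : z ^+ 3 * expR (- z) <= 3 / 2; last by nra.
rewrite expRN ler_pdivrMr ?expR_gt0//.
(* Centring at z = 3, where z^3 e^{-z} is maximal, reduces the bound to the tangent inequality z/3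
   <= e^{z/3 - 1}. *)
have -> : expR z = expR 3 * expR (z / 3 - 1) ^+ 3.
  by rewrite -expRM_natl -expRD; congr expR; field.
have h1 : (z / 3) ^+ 3 <= expR (z / 3 - 1) ^+ 3.
  rewrite lerXn2r ?nnegrE ?expR_ge0 ?divr_ge0//.
  by have := expR_ge1Dx (z / 3 - 1); lra.
have := expR3_ge18; have : 0 <= (z / 3) ^+ 3 by rewrite exprn_ge0// divr_ge0.
rewrite (_ : z ^+ 3 = 27 * (z / 3) ^+ 3); last by field.
nra.
Qed.

(** For y >= 1 one more power of y pays for the factor 1/y of the envelope, whence (n+1)! in place
    of n!. This turns the envelope bound into bounds on the sums of p_j^n e^{-t p_j}. *)
Lemma powM_expRN_le_envelope n y : (1 < n)%N -> 0 <= y ->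
  y ^+ n * expR (- y) <= n.+1`!%:R * envelope y.
Proof.
move=> n1 y0; rewrite /envelope; case: ifPn => [y1|]; last rewrite -leNgt => y1.
  have yn : y ^+ n * expR (- y) <= y.
    rewrite -[leRHS]mulr1 ler_pM ?exprn_ge0 ?expR_ge0 ?expRN_le1//.
    by rewrite -[leRHS]expr1 ler_wiXn2l ?(ltnW n1)// ltW.
  apply: (le_trans yn).
  have : 2 <= n.+1`!%:R :> R 
    by rewrite ler_nat factS -[2%N]muln1 leq_mul ?fact_gt0// ltnS ltnW.
  by nra.
have y0' : 0 < y by lra.
rewrite mulrA ler_pdivlMr// mulrAC -exprSr.
by apply: (le_trans (powM_expRN_le _ y0)); rewrite ler_peMr ?ler0n//; lra.
Qed.

(** Below 1/A, one factor y of y^2 is at most 1/A. From A on, y^4 e^{-y} <= 4! = 8 * 3, where 3 is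
    the constant of the envelope. *)
Lemma bell_tail_le (A y : R) : 1 <= A -> 0 <= y -> y < A^-1 \/ A <= y ->
  bell y <= 8 / A * envelope y.
Proof.
move=> A1 y0 yA; have A0 : 0 < A by lra.
rewrite mulrAC ler_pdivlMr//; case: yA => [yA|Ay].
  have y1 : y < 1 by rewrite (lt_le_trans yA)// invf_le1.
  rewrite /envelope y1.
  have Ay1 : y * A <= 1 by rewrite -ler_pdivlMr// div1r ltW.
  rewrite /bell expr2 (_ : y * y * _ * A = y * A * y * expR (- y)); last by ring.
  have := expRN_le1 y0; have := expR_ge0 (- y); have : 0 <= y * A by nra.
  have : y * A * y <= y by nra.
  move: (expR (- y)) => e *; have : 0 <= y * A * y by nra.
  by nra.
rewrite /envelope ifF; last by apply/negbTE; rewrite -leNgt; lra.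
have y1 : 0 < y by lra.
rewrite mulrA ler_pdivlMr//; apply: (@le_trans _ _ (y ^+ 4 * expR (- y))).
  rewrite /bell (_ : y ^+ 4 * _ = y ^+ 2 * expR (- y) * y * y); last by ring.
  rewrite ler_pM2r// ler_wpM2l// mulr_ge0 ?exprn_ge0 ?expR_ge0//.
by apply: (le_trans (powM_expRN_le 4 y0)); rewrite !factS fact0 -natrM ler_nat.
Qed.

(** The difference of [gtail] is the integral of w |-> [bell] (e^w) over the cell, hence d times a
    value at some point of it. The derivative (2 - e^w) [bell] (e^w) of the integrand is at most 2 *
    2! + 3! = 10 in absolute value. *)
Lemma bell_cell_le u v d : u <= v <= u + d ->
  `|d * bell (expR v) - (gtail (expR u) - gtail (expR (u + d)))| <= 10 * d ^+ 2.
Proof.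
move=> /andP[uv vd]; have d0 : 0 <= d by lra.
have dG (x : R) : is_derive x 1 (gtail \o expR) (- bell (expR x)).
  have := is_derive_gtail (expR x) => ?.
  apply: is_derive_eq; rewrite /bell; ring.
have dB (x : R) :
    is_derive x 1 (bell \o expR) ((2 - expR x) * bell (expR x)).
  have ? : is_derive (expR x) 1 bell ((2 - expR x) * expR x * expR (- expR x)).
    by rewrite /bell; apply: is_derive_eq; rewrite /GRing.scale/=; ring.
  by apply: is_derive_eq; rewrite /bell; ring.
have [c /andP[uc cd] /= Gc] := MVT_le dG (ltac:(lra) : u <= u + d).
rewrite -[_ - gtail _]opprB Gc (_ : _ - _ = d * (bell (expR v) - bell (expR c)));
    last by ring.
have bdB x z : x <= z -> z - x <= d -> `|bell (expR z) - bell (expR x)| <= 10 * d.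
  move=> xz zxd; have [w _ /= ->] := MVT_le dB xz.
  rewrite normrM (ger0_norm (_ : 0 <= z - x)) ?subr_ge0//.
  rewrite ler_pM// ?subr_ge0//.
  have := powM_expRN_le 2 (expR_ge0 w); have := powM_expRN_le 3 (expR_ge0 w).
  rewrite (_ : 3`! = 6)%N// (_ : 2`! = 2)%N// -/(bell _) exprS -mulrA -/(bell _).
  have : 0 <= bell (expR w) by rewrite mulr_ge0 ?exprn_ge0 ?expR_ge0.
  have := expR_gt0 w; move: (bell _) => b; move: (expR w) => e e0 b0 b1 b2.
  by rewrite ler_norml; apply/andP; split; nra.
rewrite normrM (ger0_norm d0) expr2 mulrCA ler_wpM2l//.
have [vc|cv] := leP v c; last by apply: bdB; lra.
by rewrite distrC; apply: bdB; lra.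
Qed.

End calculus.

(** * The counting function *)

Section partial_sums.
Variable R : realType.

Lemma nneseries_partial_cvg (u : nat -> R) (r : R) : (forall j, 0 <= u j) ->
  (\sum_(0 <= j <oo) (u j)%:E = r%:E)%E ->
  (\sum_(j < N) u j) @[N --> \oo] --> r.
Proof.
move=> u0 ur; have : (\sum_(0 <= j < N) (u j)%:E)%E @[N --> \oo] --> r%:E.
  by rewrite -ur; apply: is_cvg_nneseries => n _ _; rewrite lee_fin.
move=> /fine_cvgP[_]; apply: cvg_trans; apply: near_eq_cvg; near=> N => /=.
by rewrite sumEFin big_mkord.
Unshelve. all: by end_near. Qed.

End partial_sums.

Section counting_function.
Variables (R : realType) (p : nat -> R).
Hypothesis p_pmf : is_pmf p.

Let p_ge0 j : 0 <= p j. Proof. by case: p_pmf. Qed.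

Lemma pmf_cvg : (\sum_(j < N) p j) @[N --> \oo] --> (1 : R).
Proof. by case: p_pmf => p0 p1; exact: nneseries_partial_cvg. Qed.

Lemma pmf_psum_nd (M N : nat) : (M <= N)%N -> \sum_(j < M) p j <= \sum_(j < N) p j.
Proof.
move=> /subnK <-; elim: (N - M)%N => [|k IH]; first by rewrite add0n.
by rewrite addSn big_ord_recr/= (le_trans IH)// lerDl.
Qed.

Lemma pmf_psum_le1 N : \sum_(j < N) p j <= 1.
Proof.
apply/ler_addgt0Pr => e e0; have /cvgrPdist_le/(_ _ e0) cvp := pmf_cvg.
have [M _ /(_ (maxn M N) (leq_maxl _ _))/=] := cvp.
by have := pmf_psum_nd (leq_maxr M N); rewrite ler_norml; lra.
Qed.

Lemma pmf_le1 j : p j <= 1.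
Proof.
apply: le_trans (pmf_psum_le1 j.+1); rewrite big_ord_recr/= lerDr.
by rewrite sumr_ge0.
Qed.

Lemma pmf_tail (e : R) : 0 < e -> \forall N \near \oo, 1 - \sum_(j < N) p j <= e.
Proof.
move=> e0; have /cvgrPdist_le/(_ _ e0) := pmf_cvg.
by apply: filterS => N /=; apply: le_trans; rewrite ler_norm.
Qed.

Lemma pmf_tail_sum (M N : nat) : (M <= N)%N ->
  \sum_(j < N | (M <= j)%N) p j = \sum_(j < N) p j - \sum_(j < M) p j.
Proof.
move=> MN; rewrite [X in _ = X - _](bigID (fun j : 'I_N => (j < M)%N))/=.
rewrite -[X in _ = X + _ - _](big_ord_widen N (fun i => p i) MN).
by rewrite addrAC subrr add0r; apply: eq_bigl => j; rewrite -leqNgt.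
Qed.

Lemma pmf_small (x : R) : 0 < x -> exists J, forall j, (J <= j)%N -> p j < x.
Proof.
move=> x0; have x20 : 0 < x / 2 by lra.
have [J _ HJ] := pmf_tail x20; exists J => j Jj.
have := HJ j Jj; have := pmf_psum_le1 j.+1; rewrite big_ord_recr/=; lra.
Qed.

(** The probabilities tend to 0, so only finitely many reach 1/tau. This replaces the counting
    measure by finite sums, the form in which all later counts are made. *)
Lemma ell_psum (tau : R) : 0 < tau ->
  \forall N \near \oo, ell p tau = \sum_(j < N) (tau^-1 <= p j)%R%:R.
Proof.
move=> tau0; have tv0 : 0 < tau^-1 by rewrite invr_gt0.
have [J HJ] := pmf_small tv0.
exists J => // N /= JN; rewrite /ell /nu counting_dirac.
rewrite (_ : limn _ = (\sum_(j < N) (tau^-1 <= p j)%R%:R)%:E)//.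
apply: lim_near_cst => //; exists N => // M /= NM.
rewrite (big_cat_nat _ NM)//= [X in (_ + X)%E]big_nat_cond.
rewrite [X in (_ + X)%E]big1 => [|j /andP[/andP[Nj _] _]]; last first.
  rewrite diracE memNset//= => pj.
  by have := HJ j (leq_trans JN Nj); rewrite ltNge pj.
rewrite adde0 -sumEFin big_mkord; apply: eq_bigr => j _.
rewrite diracE; have [pj|pj] := boolP (tau^-1 <= p j); first by rewrite mem_set.
by rewrite memNset//=; apply/negP.
Qed.

Lemma ell_nd (x y : R) : 0 < x -> x <= y -> ell p x <= ell p y.
Proof.
move=> x0 xy; have y0 : 0 < y by lra.
have [N _ HN] := ell_psum x0; have [M _ HM] := ell_psum y0.
rewrite (HN _ (leq_maxl N M)) (HM _ (leq_maxr N M)); apply: ler_sum => j _.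
rewrite ler_nat; case: leP => // xp; rewrite (le_trans _ xp)//.
by rewrite lef_pV2.
Qed.

Lemma cell_count_eq (t x y : R) : 0 < t -> 0 < x -> x <= y ->
  \forall N \near \oo, \sum_(j < N) (x <= t * p j < y)%R%:R =
    ell p (t / x) - ell p (t / y).
Proof.
move=> t0 x0 xy; have y0 : 0 < y by lra.
near=> N.
rewrite (near (ell_psum (divr_gt0 t0 x0)) N)//.
rewrite (near (ell_psum (divr_gt0 t0 y0)) N)//.
rewrite -sumrB; apply: eq_bigr => j _.
rewrite !invf_div !ler_pdivrMr// ![p j * t]mulrC ltNge.
have [xp|] := leP x; have [yp|] := leP y => //=; rewrite ?subrr ?subr0//.
by move=> px; lra.
Unshelve. all: by end_near. Qed.

Lemma cell_count_le (t x y : R) N : 0 < t -> 0 < x -> x <= y ->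
  \sum_(j < N) (x <= t * p j < y)%R%:R <= ell p (t / x) - ell p (t / y).
Proof.
move=> t0 x0 xy; have [M _ HM] := cell_count_eq t0 x0 xy.
rewrite -(HM _ (leq_maxl M N)) (big_ord_widen (maxn M N)
  (fun j => (x <= t * p j < y)%R%:R) (leq_maxr M N)).
by rewrite big_mkcond ler_sum// => j _; case: ifP => //; rewrite ler0n.
Qed.

End counting_function.

(** * Dyadic cells *)

Section extended_slow_variation.
Variables (R : realType) (p : nat -> R) (a : R -> R).
Hypothesis p_pmf : is_pmf p.
Hypothesis ell_Pi : ext_slow_variation (ell p) a.
Hypothesis a_slow : slowly_varying a.
Hypothesis a_infty : a x @[x --> +oo] --> +oo.

Let p_ge0 j : 0 <= p j. Proof. by case: p_pmf. Qed.

Lemma near_pinfty_ex (P : R -> Prop) : (\forall t \near +oo, P t) ->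
  exists T, 1 <= T /\ forall t, T <= t -> P t.
Proof.
move=> [M [Mr HM]]; exists (Num.max 1 (M + 1)); split; first by rewrite le_max lexx.
by move=> t; rewrite ge_max => /andP[_ Mt]; apply: HM; lra.
Qed.

Lemma near_aux_gt (M : R) : \forall t \near +oo, M < a t.
Proof. by move/cvgryPgt : a_infty => /(_ M). Qed.

(** The strict inequality leaves room for the limit log 2 in [doubling_regime]; it follows from
    e^{4/5} >= (6/5)^4 > 2. *)
Lemma ln2_lt45 : ln 2 < 4 / 5 :> R.
Proof.
have e15 : 1 + 1 / 5 <= expR (1 / 5) :> R by exact: expR_ge1Dx.
rewrite -ltr_expR lnK ?posrE//.
rewrite (_ : 4 / 5 = 4%:R * (1 / 5)); last by field.
rewrite expRM_natl; move: (expR _) e15 => e e15.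
have : 144 / 100 <= e ^+ 2 by nra.
by rewrite (_ : e ^+ 4 = e ^+ 2 * e ^+ 2); [nra|rewrite -exprD].
Qed.

(* Only the factor 2 occurs, so that the growth of a along 2^m t is controlled by
   iteration, without the uniform convergence theorem for slowly varying functions.
       *)
Lemma doubling_regime : exists T, 1 <= T /\ forall t, T <= t ->
  [/\ 0 < a t, ell p (2 * t) - ell p t <= 4 / 5 * a t,
      a (2 * t) <= 65 / 64 * a t & a t <= 65 / 64 * a (2 * t)].
Proof.
apply: near_pinfty_ex.
have [_ _ /(_ 2 ltac:(lra)) lim_l] := ell_Pi.
have /cvgrPdist_lt/(_ (1 / 65) ltac:(lra)) lim_a := a_slow (ltac:(lra) : 0 < 2 :> R).
have {}lim_l : \forall t \near +oo, (ell p (t * 2) - ell p t) / a t < 4 / 5.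
  exact: cvgr_lt lim_l _ ln2_lt45.
near=> t.
have at0 : 0 < a t by near: t; exact: near_aux_gt.
have h1 : (ell p (t * 2) - ell p t) / a t < 4 / 5 by near: t.
have h2 : `|1 - a (t * 2) / a t| < 1 / 65 by near: t.
rewrite [2 * t]mulrC; split => //.
- by rewrite -ler_pdivrMr// ltW.
- rewrite -ler_pdivrMr//; move: h2; rewrite ltr_norml; lra.
- move: h2; rewrite ltr_norml.
  have -> : a (t * 2) = a (t * 2) / a t * a t by rewrite mulfVK ?gt_eqF.
  by rewrite mulfK ?gt_eqF//; move: (a (t * 2) / a t) => u; nra.
Unshelve. all: by end_near. Qed.

Lemma dyadic_up (T : R) : 1 <= T ->
  (forall t, T <= t -> a (2 * t) <= 65 / 64 * a t) ->
  forall m t, T <= t -> a (2 ^+ m * t) <= (65 / 64) ^+ m * a t.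
Proof.
move=> T1 Ha; elim=> [|m IH] t Tt; first by rewrite !expr0 !mul1r.
rewrite !exprSr -mulrA -[leRHS]mulrA (le_trans (IH _ _))//; first by lra.
by rewrite ler_pM2l ?exprn_gt0//; exact: Ha.
Qed.

Lemma dyadic_down (T : R) : 1 <= T ->
  (forall t, T <= t -> a t <= 65 / 64 * a (2 * t)) ->
  forall m t, T <= t -> a t <= (65 / 64) ^+ m * a (2 ^+ m * t).
Proof.
move=> T1 Ha; elim=> [|m IH] t Tt; first by rewrite !expr0 !mul1r.
rewrite (le_trans (Ha _ Tt))// !exprS -[leRHS]mulrA.
rewrite ler_pM2l// (le_trans (IH (2 * t) _))//; first by lra.
by rewrite mulrCA mulrA.
Qed.

(** Each count is an increment l(2 tau) - l(tau), and the power of 65/64 counts the doublings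
    between tau and t. Cells below 1 have tau >= t, but those above 1 have tau < t, which may leave
    the range where the doubling estimates hold. *)
Lemma dyadic_counts : exists T, 1 <= T /\ forall t, T <= t -> 0 < a t /\
  forall N k,
  \sum_(j < N) (2 ^+ k <= t * p j < 2 ^+ k.+1)%R%:R <=
    4 / 5 * (65 / 64) ^+ k.+1 * a t /\
  \sum_(j < N) (2 ^- k.+1 <= t * p j < 2 ^- k)%R%:R <=
    4 / 5 * (65 / 64) ^+ k * a t.
Proof.
have [T [T1 HT]] := doubling_regime.
(* Because a tends to infinity, the fixed number l(2 T) is eventually below 4/5 a(t); this covers
   all increments with tau < T at once. *)
have [T' [_ HT']] := near_pinfty_ex (near_aux_gt (5 / 4 * ell p (2 * T))).
exists (Num.max T T'); split; first by rewrite le_max T1.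
move=> t; rewrite ge_max => /andP[Tt T't].
have t0 : 0 < t by lra.
have at0 : 0 < a t by case: (HT _ Tt).
have e2 k : 0 < 2 ^+ k :> R by exact: exprn_gt0.
have r1 k : 1 <= (65 / 64) ^+ k :> R by apply: exprn_ege1; lra.
split=> // N k; split.
  apply: (le_trans (cell_count_le p_pmf _ t0 (e2 k) _)).
    by rewrite ler_eXn2l// ltr1n.
  set tau := t / 2 ^+ k.+1; have tau0 : 0 < tau by rewrite divr_gt0.
  have -> : t / 2 ^+ k = 2 * tau by rewrite /tau exprS; field; rewrite gt_eqF.
  have [Ttau|tauT] := leP T tau.
    have [_ h _ _] := HT _ Ttau; apply: (le_trans h);
        rewrite -[leRHS]mulrA ler_pM2l//.
    rewrite [t in leRHS](_ : t = 2 ^+ k.+1 * tau); last first.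
      by rewrite mulrC mulfVK// gt_eqF.
    by apply: (dyadic_down T1) => // s Ts; case: (HT _ Ts).
  apply: (@le_trans _ _ (ell p (2 * T))).
    apply: (@le_trans _ _ (ell p (2 * tau))).
      rewrite gerBl; have [M _ /(_ M (leqnn M))/= ->] := ell_psum p_pmf tau0.
      by apply: sumr_ge0 => j _.
    by apply: ell_nd => //; lra.
  have := HT' _ T't; have := r1 k.+1; move: (_ ^+ _) => r; nra.
have e2v i : 0 < 2 ^- i :> R by rewrite invr_gt0.
apply: (le_trans (cell_count_le p_pmf _ t0 (e2v _) _)).
  by rewrite lef_pV2 ?posrE// ler_eXn2l// ltr1n.
rewrite !invrK.
rewrite [t * 2 ^+ k.+1]mulrC [t * 2 ^+ k]mulrC.
rewrite (_ : 2 ^+ k.+1 * t = 2 * (2 ^+ k * t)); last by rewrite exprS mulrA.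
have Tk : T <= 2 ^+ k * t.
  by apply: (le_trans Tt); rewrite ler_peMl ?(ltW t0)// exprn_ege1// ler1n.
have [_ h _ _] := HT _ Tk; apply: (le_trans h); rewrite -[leRHS]mulrA ler_pM2l//.
by apply: (dyadic_up T1) => // s Ts; case: (HT _ Ts).
Qed.

(** On each cell the envelope is bounded by its formula at the end nearer to 1. The case y = 0 is
    for symbols of probability 0, which lie in no dyadic cell. *)
Lemma envelope_dyadic (K : nat) (y : R) : y = 0 \/ 2 ^- K <= y < 2 ^+ K ->
  envelope y <= \sum_(k < K) 3 / 2 ^+ k * (2 ^+ k <= y < 2 ^+ k.+1)%R%:R +
    \sum_(k < K) 2 ^- k / 2 * (2 ^- k.+1 <= y < 2 ^- k)%R%:R.
Proof.
have e2 k : 0 < 2 ^+ k :> R by exact: exprn_gt0.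
have t1 k : 0 <= 3 / 2 ^+ k * (2 ^+ k <= y < 2 ^+ k.+1)%R%:R :> R.
  by rewrite mulr_ge0// divr_ge0// ltW.
have t2 k : 0 <= 2 ^- k / 2 * (2 ^- k.+1 <= y < 2 ^- k)%R%:R :> R.
  by rewrite mulr_ge0// divr_ge0// ltW// invr_gt0.
have s1 n : 0 <= \sum_(k < n) 3 / 2 ^+ k * (2 ^+ k <= y < 2 ^+ k.+1)%R%:R :> R.
  by rewrite sumr_ge0.
have s2 n : 0 <= \sum_(k < n) 2 ^- k / 2 * (2 ^- k.+1 <= y < 2 ^- k)%R%:R :> R.
  by rewrite sumr_ge0.
case=> [y0|/andP[Ky yK]].
  by rewrite {1}y0 /envelope ltr01 mul0r addr_ge0.
rewrite /envelope; case: ifPn => [y1|].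
  rewrite (ler_wpDl (s1 K))//; move: Ky; elim: K {yK} => [|K IH].
    by rewrite expr0 invr1 => /le_lt_trans/(_ y1); rewrite ltxx.
  move=> Ky; rewrite big_ord_recr/=; have [/IH h|yK] := leP (2 ^- K) y.
    by rewrite ler_wpDr.
  by rewrite Ky mulr1 (ler_wpDl (s2 K))// ler_pM2r// ltW.
rewrite -leNgt => y1; rewrite (ler_wpDr (s2 K))//; move: yK; elim: K {Ky} => [|K IH].
  by rewrite expr0 => /(le_lt_trans y1); rewrite ltxx.
move=> yK; rewrite big_ord_recr/=; have [Ky|/IH h] := leP (2 ^+ K) y.
  rewrite yK/= mulr1 (ler_wpDl (s1 K))// ler_pM2l// lef_pV2 ?posrE//; lra.
by rewrite ler_wpDr.
Qed.

Lemma geometric_le K : \sum_(k < K) (65 / 128) ^+ k <= 128 / 63 :> R.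
Proof.
have -> : \sum_(k < K) (65 / 128) ^+ k = (1 - (65 / 128) ^+ K) * (128 / 63) :> R.
  elim: K => [|K IH]; first by rewrite big_ord0 expr0; ring.
  by rewrite big_ord_recr/= IH exprS; field.
have : 0 <= (65 / 128) ^+ K :> R by rewrite exprn_ge0.
by move: (_ ^+ _) => r; lra.
Qed.

(** The window depends on t and N, which is harmless because [geometric_le] is uniform in [K]. *)
Lemma dyadic_window (t : R) N : 0 < t -> exists K : nat, forall j : 'I_N,
  t * p j = 0 \/ 2 ^- K <= t * p j < 2 ^+ K.
Proof.
move=> t0; have e2 k : 0 < 2 ^+ k :> R by exact: exprn_gt0.
elim: N => [|N [K HK]]; first by exists 0%N; case.
have [K' HK'] : exists K', t * p N = 0 \/ 2 ^- K' <= t * p N < 2 ^+ K'.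
  have := p_ge0 N; rewrite le_eqVlt => /predU1P[<-|pN]; first by exists 0%N; left;
      rewrite mulr0.
  set y := t * p N; have y0 : 0 < y by rewrite mulr_gt0.
  pose k := (Num.truncn (Num.max y y^-1)).+1; exists k; right.
  have kE : Num.max y y^-1 < 2 ^+ k.
    rewrite (lt_trans (truncnS_gt _))// -natrX ltr_nat; exact: ltn_expl.
  move: kE; rewrite gt_max => /andP[-> kE]; rewrite andbT.
  by rewrite -[leRHS]invrK lef_pV2 ?posrE ?invr_gt0// ltW.
exists (maxn K K') => j; have le2 m n : (m <= n)%N -> 2 ^+ m <= 2 ^+ n :> R.
  by move=> mn; rewrite ler_weXn2l// ler1n.
have le2v m n : (m <= n)%N -> 2 ^- n <= 2 ^- m :> R.
  by move=> mn; rewrite lef_pV2 ?posrE// le2.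
have [jN|] := ltnP j N.
  have [?|/andP[h1 h2]] := HK (Ordinal jN); first by left.
  by right; rewrite (le_trans (le2v _ _ (leq_maxl _ _)) h1) (lt_le_trans h2)//
      le2// leq_maxl.
move=> Nj; have -> : nat_of_ord j = N.
  by apply/eqP; rewrite eqn_leq Nj -ltnS ltn_ord.
have [?|/andP[h1 h2]] := HK'; first by left.
by right; rewrite (le_trans (le2v _ _ (leq_maxr _ _)) h1) (lt_le_trans h2)// le2//
    leq_maxr.
Qed.

(* 4/5 > ln 2 bounds the cell counts and 65/64 the ratios a (2 t) / a t; the total is
   4/5 * (3 * 65/64 + 1/2) / (1 - 65/128) < 6. *)
Lemma envelope_sum_le : exists T, 1 <= T /\ forall t, T <= t -> 0 < a t /\
  forall N, \sum_(j < N) envelope (t * p j) <= 6 * a t.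
Proof.
have [T [T1 HT]] := dyadic_counts; exists T; split=> // t Tt.
have [at0 cnt] := HT _ Tt; split=> // N.
have e2 k : 0 < 2 ^+ k :> R by exact: exprn_gt0.
have t0 : 0 < t by lra.
have [K HK] := dyadic_window N t0.
apply: (le_trans (ler_sum _ (fun j _ => envelope_dyadic (HK j)))).
rewrite big_split/= exchange_big/= [X in _ + X]exchange_big/=.
apply: (@le_trans _ _ (\sum_(k < K) (39 / 16 + 2 / 5) * a t * (65 / 128) ^+ k)).
  rewrite -big_split/=; apply: ler_sum => k _.
  rewrite -!mulr_sumr; have [c1 c2] := cnt N k.
  rewrite (_ : (_ + _) * _ * _ =
    3 / 2 ^+ k * (4 / 5 * (65 / 64) ^+ k.+1 * a t) +
    2 ^- k / 2 * (4 / 5 * (65 / 64) ^+ k * a t)); last first.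
    rewrite (_ : 65 / 128 = 65 / 64 / 2); last by field.
    by rewrite expr_div_n exprS; field; rewrite gt_eqF.
  by rewrite lerD// ler_wpM2l// divr_ge0// ltW// invr_gt0.
rewrite -mulr_sumr; have := geometric_le K; move: (\sum_(k < K) _) => s; nra.
Qed.

End extended_slow_variation.

(** * The second moment sum *)

Section riemann.
Variable R : realType.

Lemma grid_cell (u : nat -> R) (n : nat) (y : R) : u 0%N <= y < u n ->
  exists2 i, (i < n)%N & u i <= y < u i.+1.
Proof.
elim: n => [/andP[h /(le_lt_trans h)]|n IH /andP[h yn]]; first by rewrite ltxx.
have [ny|yn'] := leP (u n) y; first by exists n; rewrite ?ny.
by have [|i ni hi] := IH; [rewrite h|exists i => //; rewrite ltnW].
Qed.

(** [g i] is the mean of w |-> [bell] (e^w) over the i-th cell of a grid of mesh d on [-b, b]. If ln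
    y lies in the window, exactly one indicator is 1 and [bell_cell_le] divided by d applies;
    otherwise all indicators vanish and [bell_tail_le] applies with A = e^b. *)
Lemma bell_grid_le (b d : R) (n : nat) (y : R) (u := fun i : nat => - b + i%:R * d)
    (g := fun i => (gtail (expR (u i)) - gtail (expR (u i.+1))) / d)
    (ind := fun i => (expR (u i) <= y < expR (u i.+1))%R%:R : R) :
  0 <= b -> 0 < d -> n%:R * d = 2 * b -> 0 <= y ->
  `|bell y - \sum_(i < n) g i * ind i| <=
    8 / expR b * envelope y + 10 * d * \sum_(i < n) ind i.
Proof.
move=> b0 d0 nd y0; have env0 := envelope_ge0 y0.
have u0 : u 0%N = - b by rewrite /u mul0r addr0.
have un : u n = b by rewrite /u nd; ring.
have uS i : u i.+1 = u i + d by rewrite /u -natr1; ring.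
have u_nd : {homo u : i j / (i <= j)%N >-> i <= j}.
  by move=> i j ij; rewrite /u lerD2l ler_pM2r// ler_nat.
have ind0 i : 0 <= ind i by rewrite ler0n.
have [yin|yout] := boolP (expR (u 0%N) <= y < expR (u n)).
  have [i ni yi] := grid_cell (u := expR \o u) yin.
  have indE j : ind j = (j == i)%:R.
    rewrite /ind; have [->|ji] := eqVneq; first by move: yi => /= ->.
    move: yi => /= /andP[iy yi]; case: ltngtP ji => // ij _.
      have h : expR (u j.+1) <= y by apply: le_trans iy; rewrite ler_expR u_nd.
      by rewrite (le_gtF h) andbF.
    have h : y < expR (u j) by apply: (lt_le_trans yi); rewrite ler_expR u_nd.
    by rewrite (lt_geF h).
  pose i' := Ordinal ni.
  have sumE (h : nat -> R) : \sum_(j < n) h j * ind j = h i.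
    rewrite (bigD1 i')//= big1 ?addr0 => [|j /negbTE ji].
      by rewrite indE eqxx mulr1.
    by rewrite indE -[i]/(nat_of_ord i') [nat_of_ord j == _]ji mulr0.
  have := sumE (fun=> 1); rewrite sumE; under eq_bigr do rewrite mul1r.
  move=> ->; rewrite mulr1 ler_wpDl//.
    by rewrite mulr_ge0// divr_ge0// expR_ge0.
  have y1 : 0 < y by case/andP: yin => /(lt_le_trans (expR_gt0 _)).
  have := @bell_cell_le R (u i) (ln y) d; rewrite lnK ?posrE// => h.
  rewrite -(ler_pM2l d0) -{1}(ger0_norm (ltW d0)) -normrM.
  rewrite (_ : d * (bell y - g i) =
     d * bell y - (gtail (expR (u i)) - gtail (expR (u i + d)))); last first.
    by rewrite -uS /g; field; rewrite gt_eqF.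
  apply: (le_trans (h _)); last by rewrite le_eqVlt; apply/orP; left; apply/eqP;
      ring.
  move: yi => /= /andP[h1 h2]; rewrite -ler_expR lnK ?posrE// h1/=.
  by rewrite -uS -ler_expR lnK ?posrE// ltW.
have indE (i : 'I_n) : ind i = 0.
  rewrite /ind; apply/eqP; rewrite pnatr_eq0 eqb0;
      apply: contra yout => /andP[h1 h2].
  apply/andP; split; first by apply: le_trans h1; rewrite ler_expR u_nd.
  by apply: (lt_le_trans h2); rewrite ler_expR u_nd.
rewrite !big1 ?mulr0 ?addr0 ?subr0 => [||i _]; last 2 first.
- by move=> i _; rewrite indE.
- by rewrite indE mulr0.
rewrite ger0_norm ?mulr_ge0 ?exprn_ge0 ?expR_ge0//.
apply: bell_tail_le => //; first by rewrite -expR0 ler_expR.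
by move: yout; rewrite u0 un expRN negb_and -ltNge -leNgt => /orP.
Qed.

(** The difference is the integral of [bell] y / y over the window, and the integral over the
    half-line is 1. With x = e^{-b}, the lower end costs at most x and the upper end at most 4 x. *)
Lemma gtail_window (b : R) : 0 <= b ->
  `|gtail (expR (- b)) - gtail (expR b) - 1| <= 5 / expR b.
Proof.
move=> b0; have e1 : 1 <= expR b by rewrite -expR0 ler_expR.
have ev : expR (- b) <= 1 by exact: expRN_le1.
have ev0 := expR_gt0 (- b).
rewrite -expRN; set x := expR (- b).
have g1 : 1 - x <= gtail x.
  have : 1 - x <= expR (- x) by exact: expR_ge1Dx.
  by rewrite /gtail; move: (expR (- x)) => w; rewrite /x; nra.
have g2 : gtail x <= 1.
  rewrite /gtail expRN ler_pdivrMr ?expR_gt0// mul1r; exact: expR_ge1Dx.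
have g3 : 0 <= gtail (expR b) by rewrite mulr_ge0 ?expR_ge0 ?addr_ge0 ?expR_ge0.
have g4 : gtail (expR b) <= 4 * x.
  have := powM_expRN_le 2 (expR_ge0 b); rewrite /gtail /x [expR (- b)]expRN.
  have := expR_gt0 (- expR b); move: (expR (- expR b)) (expR b) e1 => w e e1 w0.
  rewrite (_ : 2`!%:R = 2)// => ew; rewrite ler_pdivlMr; last by lra.
  by nra.
by rewrite ler_norml; lra.
Qed.

End riemann.

(** * Asymptotics of the sum of [bell] (t p_j), and a(t) = o(t) *)

Section bell_asymptotics.
Variables (R : realType) (p : nat -> R) (a : R -> R).
Hypothesis p_pmf : is_pmf p.
Hypothesis ell_Pi : ext_slow_variation (ell p) a.
Hypothesis a_slow : slowly_varying a.
Hypothesis a_infty : a x @[x --> +oo] --> +oo.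

Let p_ge0 j : 0 <= p j. Proof. by case: p_pmf. Qed.

(** The limits defining the extended slow variation at e^{-u} and e^{-v} are subtracted: a cell
    receives a number of points proportional to its logarithmic length. *)
Lemma cell_limit (u v : R) :
  (ell p (t / expR u) - ell p (t / expR v)) / a t @[t --> +oo] --> v - u.
Proof.
have [_ _ lim_l] := ell_Pi.
have lu := lim_l _ (expR_gt0 (- u)); have lv := lim_l _ (expR_gt0 (- v)).
have -> : v - u = ln (expR (- u)) - ln (expR (- v)) by rewrite !expRK; ring.
apply: cvg_trans (cvgB lu lv); apply: near_eq_cvg; near=> t => /=.
by rewrite !fctE -mulrBl !expRN; congr (_ / _); rewrite opprB addrA subrK.
Unshelve. all: by end_near. Qed.

(** The sum over j of the step function of [bell_grid_le] is a fixed finite combination of cell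
    counts, so [cell_limit] gives its limit after division by a(t). The error outside the window is
    controlled uniformly by [envelope_sum_le]. *)
Lemma bell_sum_asymp (e : R) : 0 < e -> \forall t \near +oo,
  \forall N \near \oo, `|\sum_(j < N) bell (t * p j) - a t| <= e * a t.
Proof.
move=> e0.
(* Here 53 = 8 * 6 + 5 collects the tail error of the grid and the error of [gtail_window]; 212 = 4
   * 53 makes them at most e/4. *)
pose b := Num.max 1 (ln (212 / e)); have b1 : 1 <= b by rewrite le_max lexx.
have b0 : 0 < b by lra.
have be : 53 / expR b <= e / 4.
  have : 212 / e <= expR b.
    by rewrite -[leLHS]lnK ?posrE ?divr_gt0// ler_expR le_max lexx orbT.
  by rewrite !ler_pdivrMr ?expR_gt0//; lra.
(* The mesh error tends to 10 d * 2 b = 40 b^2 / n, which this choice puts below e/2; the last e/4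
   is left for the limit [lim2]. *)
pose n := (Num.truncn (80 * b ^+ 2 / e)).+1.
have n0 : 0 < n%:R :> R by rewrite ltr0n.
have nE : 80 * b ^+ 2 / e < n%:R by exact: truncnS_gt.
pose d := 2 * b / n%:R; have d0 : 0 < d by rewrite divr_gt0// mulr_gt0.
have nd : n%:R * d = 2 * b by rewrite /d mulrC mulfVK ?gt_eqF.
have ndd : 10 * d * (2 * b) < e / 2.
  rewrite (_ : 10 * d * (2 * b) = 40 * b ^+ 2 / n%:R); last first.
    by rewrite /d; field; rewrite gt_eqF.
  by rewrite ltr_pdivrMr//; move: nE; rewrite ltr_pdivrMr//; lra.
pose u := fun i : nat => - b + i%:R * d.
pose g := fun i => (gtail (expR (u i)) - gtail (expR (u i.+1))) / d.
pose D := fun i t => ell p (t / expR (u i)) - ell p (t / expR (u i.+1)).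
have uS i : u i.+1 - u i = d by rewrite /u -natr1; ring.
have limD i : D i t / a t @[t --> +oo] --> d.
  by rewrite -(uS i); exact: cell_limit.
have lim1 : 10 * d * (\sum_(i < n) D i t / a t) @[t --> +oo] --> 10 * d * (2 * b).
  apply: cvgM; first exact: cvg_cst.
  rewrite -nd (_ : n%:R * d = \sum_(i < n) d); last first.
    by rewrite sumr_const card_ord mulr_natl.
  by apply: cvg_big => //; exact: add_continuous.
have lim2 : \sum_(i < n) g i * (D i t / a t) @[t --> +oo] -->
    gtail (expR (- b)) - gtail (expR b).
  have -> : gtail (expR (- b)) - gtail (expR b) = \sum_(i < n) g i * d.
    rewrite -[LHS]opprB (_ : - b = u 0%N); last by rewrite /u mul0r addr0.
    rewrite [X in gtail (expR X) - _](_ : _ = u n); last by rewrite /u nd; ring.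
    rewrite -(telescope_sumr (fun i => gtail (expR (u i))) (leq0n n)) big_mkord.
    rewrite -sumrN; apply: eq_bigr => i _.
    by rewrite /g mulfVK ?gt_eqF// opprB.
  apply: cvg_big => //; first exact: add_continuous.
  by move=> i _; apply: cvgM => //; exact: cvg_cst.
have [T [T1 env]] := envelope_sum_le p_pmf ell_Pi a_slow a_infty.
near=> t.
have Tt : T <= t by near: t; apply: nbhs_pinfty_ge; exact: num_real.
have t0 : 0 < t by lra.
have [at0 {}env] := env _ Tt.
have h1 : 10 * d * (\sum_(i < n) D i t / a t) < e / 2.
  by near: t; exact: cvgr_lt lim1 _ ndd.
have h2 : `|(gtail (expR (- b)) - gtail (expR b)) - \sum_(i < n) g i * (D i t / a
    t)| < e / 4.
  by near: t; move/cvgrPdist_lt : lim2; apply; lra.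
have h3 := gtail_window (ltW b0).
near=> N.
have cells i : (i < n)%N ->
    \sum_(j < N) (expR (u i) <= t * p j < expR (u i.+1))%R%:R = D i t.
  move=> ni; rewrite -[i]/(nat_of_ord (Ordinal ni)); move: (Ordinal ni).
  near: N; apply: filter_forall => {}i.
  apply: cell_count_eq => //; first exact: expR_gt0.
  by rewrite ler_expR -subr_ge0 uS ltW.
have : `|\sum_(j < N) bell (t * p j) - \sum_(i < n) g i * D i t| <=
    8 / expR b * (6 * a t) + 10 * d * \sum_(i < n) D i t.
  rewrite (_ : \sum_(i < n) g i * D i t = \sum_(j < N) \sum_(i < n)
      g i * (expR (u i) <= t * p j < expR (u i.+1))%R%:R); last first.
    by rewrite exchange_big/=; apply: eq_bigr => i _; rewrite -mulr_sumr cells.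
  rewrite -sumrB (le_trans (ler_norm_sum _ _ _))//.
  have tp j : 0 <= t * p j by rewrite mulr_ge0 ?(ltW t0).
  apply: (@le_trans _ _ (\sum_(j < N) (8 / expR b * envelope (t * p j) +
      10 * d * \sum_(i < n) (expR (u i) <= t * p j < expR (u i.+1))%R%:R))).
    by apply: ler_sum => j _; exact: (bell_grid_le (ltW b0) d0 nd (tp j)).
  rewrite big_split/= -!mulr_sumr lerD//.
    by apply: ler_wpM2l; [rewrite divr_ge0 ?expR_ge0|exact: env].
  rewrite exchange_big/= le_eqVlt; apply/orP; left.
  by apply/eqP; congr (_ * _); apply: eq_bigr => i _; exact: cells.
have gD : \sum_(i < n) g i * (D i t / a t) = (\sum_(i < n) g i * D i t) / a t.
  by rewrite mulr_suml; apply: eq_bigr => i _; rewrite mulrA.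
move: h1 h2; rewrite -mulr_suml gD.
move: (\sum_(i < n) D i t) (\sum_(i < n) g i * D i t) (\sum_(j < N) _) => D1 D2 S.
move: (h3) (be); have : 0 <= (expR b)^-1 by rewrite invr_ge0 expR_ge0.
move: (gtail _) (gtail _) (expR b)^-1 => G1 G2 x x0 w1 w2.
rewrite mulrA ltr_pdivrMr// => h1.
rewrite -(ltr_pM2r at0) -[X in _ * X < _](ger0_norm (ltW at0)) -normrM.
rewrite mulrBl (mulfVK (lt0r_neq0 at0)) => h2.
move: w1; rewrite -(ler_pM2r at0) -[X in _ * X <= _](ger0_norm (ltW at0)) -normrM
    => w1.
have {}w2 : 53 * x * a t <= e / 4 * a t by rewrite ler_pM2r.
move: h2 w1; rewrite ltr_norml !ler_norml; lra.
Unshelve. all: by end_near. Qed.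

(** By [bell_sum_asymp], a(t) is at most twice a partial sum of [bell] (t p_j). There the first M
    terms are at most 2 each, and the others at most t p_j, with total at most t times the tail of
    the pmf. *)
Lemma aux_over_id (e : R) : 0 < e -> \forall t \near +oo, a t <= e * t.
Proof.
move=> e0; have e4 : 0 < e / 8 by lra.
have [M _ HM] := pmf_tail p_pmf e4.
have h2 : 0 < 1 / 2 :> R by lra.
near=> t.
have t1 : 1 <= t by near: t; apply: nbhs_pinfty_ge; exact: num_real.
have tM : 8 * M%:R / e <= t by near: t; apply: nbhs_pinfty_ge; exact: num_real.
have /filter_ex[N] : \forall N \near \oo, (M <= N)%N /\
    `|\sum_(j < N) bell (t * p j) - a t| <= 1 / 2 * a t.
  apply: filterI; first exact: nbhs_infty_ge.
  by near: t; exact: bell_sum_asymp.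
have bell_le (y : R) : 0 <= y -> bell y <= 2 /\ bell y <= y.
  move=> y0; split; first exact: (powM_expRN_le 2 y0).
  rewrite /bell expr2 -mulrA -[leRHS]mulr1 ler_wpM2l//.
  exact: (powM_expRN_le 1 y0).
have tp j : 0 <= t * p j by rewrite mulr_ge0//; lra.
case=> MN; have : \sum_(j < N) bell (t * p j) <= 2 * M%:R + t * (e / 8).
  rewrite (bigID (fun j : 'I_N => (j < M)%N))/= lerD//.
    rewrite -(big_ord_widen N (fun j => bell (t * p j)) MN).
    rewrite (_ : 2 * M%:R = \sum_(j < M) 2);
        last by rewrite sumr_const card_ord mulr_natr.
    by apply: ler_sum => j _; case: (bell_le _ (tp j)).
  apply: (@le_trans _ _ (\sum_(j < N | ~~ (j < M)%N) t * p j)).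
    by apply: ler_sum => j _; case: (bell_le _ (tp j)).
  have t0 : 0 < t by lra.
  rewrite -mulr_sumr (ler_pM2l t0).
  under eq_bigl do rewrite -leqNgt.
  rewrite pmf_tail_sum//; have := HM M (leqnn M); have := pmf_psum_le1 p_pmf N; lra.
move: tM; rewrite ler_pdivrMr// ler_norml; lra.
Unshelve. all: by end_near. Qed.

End bell_asymptotics.

(** * Weighted sums of indicators *)

Section finite_mean.
Context d (T : measurableType d) (R : realType) (P : probability T R).

Lemma bounded_prob_integrable (f : T -> R) (C : R) : measurable_fun setT f ->
  (forall w, `|f w| <= C) -> P.-integrable setT (EFin \o f).
Proof.
move=> mf fC; apply: measurable_bounded_integrable => //.
  exact: fin_num_fun_lty.
by exists C; split; [exact: num_real|move=> D CD w _;
    exact: le_trans (fC w) (ltW CD)].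
Qed.

Lemma integral_indic_comb (I : finType) (c : I -> R) (A : I -> set T) (q : I -> R) :
  (forall i, 0 <= c i) -> (forall i, measurable (A i)) ->
  (forall i, P (A i) = (q i)%:E) ->
  (\int[P]_w (\sum_i c i * \1_(A i) w)%:E = (\sum_i c i * q i)%:E)%E.
Proof.
move=> c0 mA PA.
under eq_integral do rewrite -sumEFin.
rewrite (ge0_integral_sum _ measurableT (f := fun i w => (c i * \1_(A i) w)%:E));
    last 2 first.
- by move=> i; apply/measurable_EFinP; apply: measurable_funM => //;
    exact: measurable_indic.
- by move=> i w _; rewrite lee_fin mulr_ge0// indicE.
rewrite -sumEFin; apply: eq_bigr => i _.
under eq_integral do rewrite EFinM.
rewrite ge0_integralZl_EFin//.
- by rewrite integral_indic// setIT EFinM; congr (_ * _)%E; exact: PA.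
- by apply/measurable_EFinP; exact: measurable_indic.
Qed.

End finite_mean.

(* The events {w | b j w} are only known through the probabilities of their finite
   intersections, which depend on the total p-weight alone through q. *)
Section weighted_events.
Context d (T : measurableType d) (R : realType) (P : probability T R).
Variables (p : nat -> R) (b : nat -> T -> bool) (q : R -> R).
Hypothesis p_pmf : is_pmf p.
Hypothesis mb : forall j, measurable [set w | b j w].
Hypothesis Pb : forall N (J : {set 'I_N}),
  P [set w | forall j, j \in J -> b j w] = (q (\sum_(j in J) p j))%:E.

Let p_ge0 j : 0 <= p j. Proof. by case: p_pmf. Qed.

(** Both missing masses are instances by mere unfolding, with [b j w] saying that the symbol [j] has
    not been drawn. *)
Definition event_mass (w : T) : R :=
  fine (\sum_(0 <= j <oo) (p j * (b j w)%:R)%:E)%E.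
Definition event_psum (N : nat) (w : T) : R := \sum_(j < N) p j * (b j w)%:R.
Definition pmf_rest (N : nat) : R := 1 - \sum_(j < N) p j.

Let pb_le j w : p j * (b j w)%:R <= p j.
Proof. by rewrite ler_piMr// lern1 leq_b1. Qed.

Let pb_ge0 j w : 0 <= p j * (b j w)%:R.
Proof. by rewrite mulr_ge0. Qed.

Lemma event_psum_ge0 N w : 0 <= event_psum N w.
Proof. exact: sumr_ge0. Qed.

Lemma event_psum_le1 N w : event_psum N w <= 1.
Proof. by apply: le_trans (pmf_psum_le1 p_pmf N); apply: ler_sum. Qed.

Lemma event_psum_cvg w : event_psum N w @[N --> \oo] --> event_mass w.
Proof.
apply: (nneseries_partial_cvg (u := fun j => p j * (b j w)%:R)) => //;
    rewrite fineK// ge0_fin_numE; last first.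
  by apply: nneseries_ge0 => j _ _; rewrite lee_fin.
apply: (@le_lt_trans _ _ (\sum_(0 <= j <oo) (p j)%:E)%E).
  by apply: lee_nneseries => j _; rewrite lee_fin.
by have [_ ->] := p_pmf; rewrite ltry.
Qed.

Lemma event_psum_bounds N M w : (N <= M)%N ->
  event_psum N w <= event_psum M w <=
    event_psum N w + (\sum_(j < M) p j - \sum_(j < N) p j).
Proof.
move=> /subnK <-; elim: (M - N)%N => [|k /andP[h1 h2]].
  by rewrite add0n subrr addr0 lexx.
rewrite addSn /event_psum !big_ord_recr/= -!/(event_psum _ _).
have := pb_le (k + N) w; have := pb_ge0 (k + N) w.
by move: h1 h2; rewrite /event_psum; lra.
Qed.

(** The truncation error is uniform in w, so estimates on finite sums pass to the series by
    monotonicity of the integral alone. *)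
Lemma event_mass_bounds N w :
  event_psum N w <= event_mass w <= event_psum N w + pmf_rest N.
Proof.
have near_b (e : R) : 0 < e -> exists2 M, (N <= M)%N & `|event_mass w - event_psum
    M w| <= e.
  move=> e0; have /cvgrPdist_le/(_ _ e0)[M _ HM] := @event_psum_cvg w.
  by exists (maxn N M); [exact: leq_maxl|apply: HM => /=; exact: leq_maxr].
apply/andP; split; apply/ler_addgt0Pr => e /near_b[M NM];
  have /andP[h1 h2] := event_psum_bounds w NM;
  have := pmf_psum_le1 p_pmf M; rewrite /pmf_rest ler_norml; lra.
Qed.

Lemma event_mass_ge0 w : 0 <= event_mass w.
Proof. by have /andP[h _] := event_mass_bounds 0 w;
    exact: le_trans (event_psum_ge0 0 w) h. Qed.

Lemma event_mass_le1 w : event_mass w <= 1.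
Proof.
have /andP[_] := event_mass_bounds 0 w.
by rewrite /event_psum /pmf_rest !big_ord0 subr0 add0r.
Qed.

Lemma measurable_bool_fun j : measurable_fun setT (fun w => (b j w)%:R : R).
Proof.
rewrite (_ : (fun w => _) = \1_[set w | b j w]); first exact: measurable_indic.
apply/funext => w; rewrite indicE; case: (boolP (b j w)) => bw.
  by rewrite mem_set.
by rewrite memNset//=; apply/negP.
Qed.

Lemma measurable_event_psum N : measurable_fun setT (event_psum N).
Proof.
rewrite /event_psum; under eq_fun do rewrite -(big_mkord xpredT (fun j => p j * (b
    j _)%:R)).
by apply: measurable_sum => j; apply: measurable_funM => //;
    exact: measurable_bool_fun.
Qed.

Lemma measurable_event_mass : measurable_fun setT event_mass.
Proof.
apply: (measurable_fun_cvg (h := event_psum)) => [N|w _];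
    first exact: measurable_event_psum.
exact: event_psum_cvg.
Qed.

Definition all_events N (J : {set 'I_N}) : set T := [set w | forall j, j \in J -> b
    j w].

Lemma measurable_all_events N (J : {set 'I_N}) : measurable (all_events J).
Proof.
rewrite (_ : all_events J = \bigcap_(j in [set j | j \in J]) [set w | b j w]).
  by apply: fin_bigcap_measurable => //; exact: finite_finset.
by apply/seteqP; split => w /= h j; exact: h.
Qed.

Lemma indic_all_events N (J : {set 'I_N}) w :
  \1_(all_events J) w = \prod_(j in J) (b j w)%:R :> R.
Proof.
rewrite indicE; have [h|h] := boolP [forall j in J, b j w].
  rewrite mem_set; last by move=> j; exact: (forall_inP h).
  by rewrite big1// => j jJ; rewrite (forall_inP h).
rewrite memNset/=; last by move=> h'; case/negP: h; apply/forall_inP => j; exact: h'.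
move: h => /forall_inPn[j jJ /negbTE bj].
by rewrite (bigD1 j)//= bj mul0r.
Qed.

Lemma expR_event_psum lambda N w : expR (lambda * event_psum N w) =
  \sum_(J : {set 'I_N}) (\prod_(j in J) (expR (lambda * p j) - 1)) * \1_(all_events
      J) w.
Proof.
rewrite /event_psum mulr_sumr expR_sum.
transitivity (\prod_(j < N) ((expR (lambda * p j) - 1) * (b j w)%:R + 1)).
  apply: eq_bigr => j _; case: (b j w); rewrite /= ?mulr1 ?mulr0 ?subrK//.
  by rewrite expR0 add0r.
rewrite bigA_distr; apply: eq_big => [J|J _]; first by rewrite inE.
rewrite indic_all_events -big_split/= [RHS]big_mkcond/=.
by apply: eq_bigr => j _; case: ifP.
Qed.

Lemma event_psum_mgf lambda N : 0 <= lambda ->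
  (\int[P]_w (expR (lambda * event_psum N w))%:E = (\sum_(J : {set 'I_N})
    (\prod_(j in J) (expR (lambda * p j) - 1)) * q (\sum_(j in J) p j))%:E)%E.
Proof.
move=> l0; under eq_integral do rewrite expR_event_psum.
apply: integral_indic_comb => J; [|exact: measurable_all_events|exact: Pb].
by rewrite prodr_ge0// => j _; rewrite subr_ge0 -expR0 ler_expR mulr_ge0.
Qed.

Lemma event_psum_mean N :
  (\int[P]_w (event_psum N w)%:E = (\sum_(j < N) p j * q (p j))%:E)%E.
Proof.
transitivity (\int[P]_w (\sum_(j < N) p j * \1_(all_events [set j]%SET) w)%:E)%E.
  apply: eq_integral => w _; congr EFin; apply: eq_bigr => j _.
  by rewrite indic_all_events big_set1.
apply: integral_indic_comb => // j; first exact: measurable_all_events.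
by have := Pb [set j]%SET; rewrite big_set1.
Qed.

(** Summing over the set, rather than adding [p i] and [p j], counts a diagonal pair once, so that
    [q] gives the joint probability for i = j too. *)
Definition pair_mass N (i j : 'I_N) : R := \sum_(k in [set i; j]%SET) p k.

Lemma event_psum_sqr_mean N : (\int[P]_w (event_psum N w ^+ 2)%:E =
  (\sum_(i < N) \sum_(j < N) p i * p j * q (pair_mass i j))%:E)%E.
Proof.
transitivity (\int[P]_w (\sum_(k : 'I_N * 'I_N)
    p k.1 * p k.2 * \1_(all_events [set k.1; k.2]%SET) w)%:E)%E.
  apply: eq_integral => w _; congr EFin.
  rewrite expr2 /event_psum big_distrlr/= pair_bigA/=; apply: eq_bigr => -[i j] _ /=.
  rewrite indic_all_events; have [<-|ij] := eqVneq i j.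
    by rewrite finset.setUid big_set1; case: (b i w); rewrite /= ?mulr1 ?mulr0.
  by rewrite big_setU1 ?inE//= big_set1; ring.
rewrite pair_bigA; apply: integral_indic_comb => k; first by rewrite mulr_ge0.
  exact: measurable_all_events.
exact: Pb.
Qed.

Lemma event_mass_integrable : P.-integrable setT (EFin \o event_mass).
Proof.
apply: (@bounded_prob_integrable _ _ _ _ _ 1); first exact: measurable_event_mass.
by move=> w; rewrite ger0_norm ?event_mass_ge0 ?event_mass_le1.
Qed.

Lemma event_mass_sqr_integrable :
  P.-integrable setT (EFin \o (fun w => event_mass w ^+ 2)).
Proof.
apply: (@bounded_prob_integrable _ _ _ _ _ 1).
  exact: measurable_funX measurable_event_mass.
move=> w; rewrite ger0_norm ?exprn_ge0 ?event_mass_ge0// exprn_ile1//.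
- exact: event_mass_ge0.
- exact: event_mass_le1.
Qed.

Lemma event_psum_integrable N : P.-integrable setT (EFin \o event_psum N).
Proof.
apply: (@bounded_prob_integrable _ _ _ _ _ 1); first exact: measurable_event_psum.
by move=> w; rewrite ger0_norm ?event_psum_ge0 ?event_psum_le1.
Qed.

Lemma event_psum_sqr_integrable N :
  P.-integrable setT (EFin \o (fun w => event_psum N w ^+ 2)).
Proof.
apply: (@bounded_prob_integrable _ _ _ _ _ 1).
  exact: measurable_funX (measurable_event_psum N).
move=> w; rewrite ger0_norm ?exprn_ge0 ?event_psum_ge0// exprn_ile1//.
- exact: event_psum_ge0.
- exact: event_psum_le1.
Qed.

Lemma Rintegral_prob_cst (r : R) : \int[P]_w r = r.
Proof.
rewrite Rintegral_cst// -[RHS]mulr1; congr (_ * _).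
by rewrite -[RHS]/(fine 1%E); congr fine; exact: probability_setT.
Qed.

Lemma cst_prob_integrable (r : R) : P.-integrable setT (EFin \o cst r).
Proof. by apply: (@bounded_prob_integrable _ _ _ _ _ `|r|). Qed.

Lemma Rintegral_squeeze (f g : T -> R) (e : R) :
  P.-integrable setT (EFin \o f) -> P.-integrable setT (EFin \o g) ->
  (forall w, f w <= g w <= f w + e) ->
  \int[P]_w f w <= \int[P]_w g w <= \int[P]_w f w + e.
Proof.
move=> intf intg fg; apply/andP; split.
  by apply: le_Rintegral => // w _; case/andP: (fg w).
rewrite -[e in leRHS]Rintegral_prob_cst -RintegralD//;
    last exact: cst_prob_integrable.
apply: le_Rintegral => //; last by move=> w _; case/andP: (fg w).
rewrite (_ : _ \o _ = (EFin \o f) \+ (EFin \o cst e))%E//.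
by apply: integrableD => //; exact: cst_prob_integrable.
Qed.

Lemma event_mass_mean_bounds N : \sum_(j < N) p j * q (p j) <=
  fine 'E_P[event_mass] <= \sum_(j < N) p j * q (p j) + pmf_rest N.
Proof.
have <- : \int[P]_w event_psum N w = \sum_(j < N) p j * q (p j).
  by rewrite /Rintegral event_psum_mean.
rewrite unlock; apply: Rintegral_squeeze; first exact: event_psum_integrable.
  exact: event_mass_integrable.
exact: event_mass_bounds.
Qed.

Lemma pmf_rest_ge0 N : 0 <= pmf_rest N.
Proof. by rewrite subr_ge0 pmf_psum_le1. Qed.

Lemma event_mass_sqr_mean_bounds N :
  let s := \sum_(i < N) \sum_(j < N) p i * p j * q (pair_mass i j) in
  s <= \int[P]_w (event_mass w ^+ 2) <= s + 2 * pmf_rest N.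
Proof.
cbv zeta; set s := \sum_(i < N) _.
have <- : \int[P]_w (event_psum N w ^+ 2) = s.
  by rewrite /Rintegral event_psum_sqr_mean.
apply: Rintegral_squeeze; first exact: event_psum_sqr_integrable.
  exact: event_mass_sqr_integrable.
(* Both masses lie in [0, 1], so their squares differ by at most twice their difference; hence the
   factor 2. *)
move=> w; have /andP[] := event_mass_bounds N w; have := pmf_rest_ge0 N.
have := event_psum_ge0 N w; have := event_mass_ge0 w.
have := event_psum_le1 N w; have := event_mass_le1 w.
move: (event_psum _ _) (event_mass _) (pmf_rest N) => x y r *.
by apply/andP; split; nra.
Qed.

Lemma event_mass_varianceE : fine 'V_P[event_mass] =
  \int[P]_w (event_mass w ^+ 2) - fine 'E_P[event_mass] ^+ 2.
Proof.
rewrite /variance unlock; set m := fine 'E_P[event_mass].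
rewrite unlock -/(Rintegral P setT _).
have mE : m = \int[P]_w event_mass w by rewrite /m unlock.
transitivity (\int[P]_w ((event_mass w ^+ 2 + (- 2 * m) * event_mass w) + m ^+ 2)).
  by apply: eq_Rintegral => w _ /=; ring.
have int1 : P.-integrable setT (EFin \o (fun w => (- 2 * m) * event_mass w)).
  rewrite (_ : _ \o _ = fun w => ((- 2 * m)%:E * (EFin \o event_mass) w)%E)//.
  by apply: integrableZl => //; exact: event_mass_integrable.
have int2 : P.-integrable setT
    (EFin \o (fun w => event_mass w ^+ 2 + (- 2 * m) * event_mass w)).
  exact: (integrableD measurableT event_mass_sqr_integrable int1).
rewrite RintegralD//; last exact: cst_prob_integrable.
rewrite RintegralD//; last exact: event_mass_sqr_integrable.
rewrite RintegralZl//; last exact: event_mass_integrable.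
by rewrite Rintegral_prob_cst -mE; ring.
Qed.

Definition psum_variance N : R :=
  \sum_(i < N) \sum_(j < N) p i * p j * (q (pair_mass i j) - q (p i) * q (p j)).

(** Passing from the partial sum to the series raises the second moment and the squared mean, each
    by at most 2 [pmf_rest N]; their difference therefore moves by no more than that. *)
Lemma event_mass_variance_approx N :
  `|fine 'V_P[event_mass] - psum_variance N| <= 2 * pmf_rest N.
Proof.
rewrite event_mass_varianceE.
have -> : psum_variance N = \sum_(i < N) \sum_(j < N) p i * p j * q (pair_mass i j) -
    (\sum_(j < N) p j * q (p j)) ^+ 2.
  rewrite /psum_variance expr2 big_distrlr/= -sumrB; apply: eq_bigr => i _.
  by rewrite -sumrB; apply: eq_bigr => j _; ring.
have /andP[] := event_mass_sqr_mean_bounds N;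
    have /andP[] := event_mass_mean_bounds N.
have /andP[h1 h2] : 0 <= fine 'E_P[event_mass] <= 1.
  have := event_mass_mean_bounds 0.
  by rewrite /pmf_rest !big_ord0 subr0 add0r.
have h3 : 0 <= \sum_(j < N) p j * q (p j).
  have <- : \int[P]_w event_psum N w = \sum_(j < N) p j * q (p j).
    by rewrite /Rintegral event_psum_mean.
  by apply: Rintegral_ge0 => w _; exact: event_psum_ge0.
have := pmf_rest_ge0 N; move: h3.
move: (\sum_(j < N) p j * q (p j)) (pmf_rest N) => mN r.
move: (\sum_(i < N) _) (\int[P]_w _) => A X.
move: (fine _) h1 h2 => m m0 m1 mN0 r0 mNm mr AX XA.
have : 0 <= m ^+ 2 - mN ^+ 2 by nra.
have : m ^+ 2 - mN ^+ 2 <= 2 * r by nra.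
by move: (m ^+ 2) (mN ^+ 2) => y z *; rewrite ler_norml; lra.
Qed.

(** Since [lambda] is positive, the coefficients of the expansion over sets are nonnegative and
    [q_sub] applies term by term. The sum then refolds into a product of factors 1 + x_j <=
    e^{x_j}. *)
Lemma log_mgf_event_mass (lambda B : R) : 0 < lambda ->
  (forall j, 0 <= q (p j)) ->
  (forall N (J : {set 'I_N}), q (\sum_(j in J) p j) <= \prod_(j in J) q (p j)) ->
  (forall N, \sum_(j < N) q (p j) * (expR (lambda * p j) - 1 - lambda * p j) <= B) ->
  (log_mgf P event_mass lambda <= B%:E)%E.
Proof.
move=> l0 q0 q_sub qB; apply/lee_addgt0Pr => e e0.
(* Truncation at N adds [lambda * pmf_rest N] to the exponent, which this N makes at most the
   arbitrary e. *)
have [N _ /(_ N (leqnn N))/= restN] := pmf_tail p_pmf (divr_gt0 e0 l0).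
rewrite -EFinD -[leRHS]expeRK /log_mgf lee_lne; last 2 first.
- by rewrite in_itv/= leey andbT expectation_ge0// => w; exact: expR_ge0.
- by rewrite in_itv/= leey andbT lee_fin expR_ge0.
set m := fine 'E_P[event_mass]; rewrite unlock.
have c0 : 0 <= expR (lambda * (pmf_rest N - m)) by exact: expR_ge0.
have mN : measurable_fun setT (fun w => (expR (lambda * event_psum N w))%:E : \bar
    R).
  apply/measurable_EFinP; apply: measurableT_comp => //.
  by apply: measurable_funM => //; exact: measurable_event_psum.
apply: (@le_trans _ _ (\int[P]_w ((expR (lambda * (pmf_rest N - m)))%:E *
    (expR (lambda * event_psum N w))%:E))%E).
  apply: ge0_le_integral => //.
  - apply/measurable_EFinP; apply: measurableT_comp => //.
    apply: measurable_funM => //; apply: measurable_funB => //.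
    exact: measurable_event_mass.
  - exact: measurable_funeM.
  - move=> w _; rewrite -EFinM lee_fin -expRD ler_expR -mulrDr ler_pM2l//.
    by have /andP[_] := event_mass_bounds N w; lra.
rewrite ge0_integralZl_EFin//.
rewrite event_psum_mgf ?(ltW l0)// -EFinM lee_fin.
have : \sum_(J : {set 'I_N}) (\prod_(j in J) (expR (lambda * p j) - 1)) *
    q (\sum_(j in J) p j) <= expR (\sum_(j < N) (expR (lambda * p j) - 1) * q (p j)).
  have e1 j : 0 <= expR (lambda * p j) - 1.
    by rewrite subr_ge0 -expR0 ler_expR mulr_ge0// ltW.
  apply: (@le_trans _ _ (\prod_(j < N) ((expR (lambda * p j) - 1) * q (p j) + 1))).
    rewrite bigA_distr [leRHS](eq_bigl xpredT); last by move=> J; rewrite inE.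
    apply: ler_sum => J _; rewrite -big_mkcond/= big_split/=.
    by apply: ler_wpM2l; [exact: prodr_ge0|exact: q_sub].
  rewrite expR_sum; apply: ler_prod => j _.
  by rewrite addr_ge0 ?mulr_ge0//= addrC expR_ge1Dx.
move=> /(ler_wpM2l c0)/le_trans; apply; rewrite -expRD ler_expR.
have /andP[mlow _] := event_mass_mean_bounds N.
have {}mlow := ler_wpM2l (ltW l0) mlow.
have : \sum_(j < N) (expR (lambda * p j) - 1) * q (p j) -
    lambda * \sum_(j < N) p j * q (p j) <= B.
  apply: le_trans (qB N); rewrite mulr_sumr -sumrB le_eqVlt; apply/orP; left.
  by apply/eqP; apply: eq_bigr => j _; ring.
have : lambda * pmf_rest N <= e by rewrite mulrC -ler_pdivlMr.
move: mlow; rewrite -/m [lambda * (pmf_rest N - m)]mulrBr.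
move: (\sum_(j < N) p j * q (p j)) => A.
move: (\sum_(j < N) (expR (lambda * p j) - 1) * q (p j)) => C.
by move: (lambda * A) (lambda * m) (lambda * pmf_rest N) => *; lra.
Qed.

End weighted_events.

(** * Avoidance probabilities *)

Section avoidance.
Context d (T : measurableType d) (R : realType) (P : probability T R).
Variables (p : nat -> R) (U : nat -> {RV P >-> nat}).
Hypothesis p_pmf : is_pmf p.
Hypothesis iidU : iid_sample p U.

Definition symbols_avoiding N (J : {set 'I_N}) : set nat :=
  [set k | forall j, j \in J -> k != nat_of_ord j].

Definition unseen n N (J : {set 'I_N}) : set T :=
  [set w | forall j, j \in J -> occupancy (fun i => U i) n j w == 0%N].

Lemma draw_avoid i N (J : {set 'I_N}) :
  P (U i @^-1` symbols_avoiding J) = (1 - \sum_(j in J) p j)%:E.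
Proof.
pose F (j : 'I_N) := U i @^-1` [set nat_of_ord j].
have mF j : measurable (F j) by exact: measurable_funPTI.
have -> : U i @^-1` symbols_avoiding J = ~` \big[setU/set0]_(j in J) F j.
  rewrite -big_enum -bigcup_seq; apply/seteqP; split => w /= h.
    by move=> [j /=]; rewrite mem_enum => jJ Uj; have := h j jJ; rewrite Uj eqxx.
  by move=> j jJ; apply/eqP => Uj; apply: h; exists j => //=; rewrite mem_enum.
rewrite probability_setC; last exact: bigsetU_measurable.
rewrite EFinB; congr (_ - _)%E.
rewrite measure_bigsetU_ord_cond//; last first.
  by move=> j k _ _ [w [/= Uj Uk]]; apply: val_inj; rewrite /= -Uj -Uk.
by rewrite -sumEFin; apply: eq_bigr => j _; case: iidU => _; exact.
Qed.

Lemma unseenE n N (J : {set 'I_N}) : unseen n J =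
  \bigcap_(i in [set` [fset i in iota 0 n]%fset]) U i @^-1` symbols_avoiding J.
Proof.
apply/seteqP; split => w /= h.
  move=> i /=; rewrite !inE/= mem_iota add0n => i_n j jJ.
  have := h j jJ; rewrite /occupancy sum_nat_eq0 => /forallP/(_ (Ordinal i_n))/=.
  by rewrite eqb0.
move=> j jJ; rewrite /occupancy sum_nat_eq0; apply/forallP => i /=.
by rewrite eqb0; apply: h => //=; rewrite !inE/= mem_iota add0n ltn_ord.
Qed.

Lemma measurable_unseen n N (J : {set 'I_N}) : measurable (unseen n J).
Proof.
rewrite unseenE; apply: fin_bigcap_measurable; first exact: finite_fset.
by move=> i _; exact: measurable_funPTI.
Qed.

(** The independence of N(t) from the draws is only given for events of the generated
    sigma-algebra. *)
Lemma unseen_sigma_of_seq n N (J : {set 'I_N}) : sigma_of_seq U (unseen n J).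
Proof.
rewrite unseenE; set G := \bigcup_i preimage_set_system setT (U i) measurable.
apply: (@fin_bigcap_measurable _ (g_sigma_algebraType G)); first exact: finite_fset.
move=> i _; apply: sub_sigma_algebra; exists i => //.
by exists (symbols_avoiding J) => //; rewrite setTI.
Qed.

Lemma prob_unseen n N (J : {set 'I_N}) :
  P (unseen n J) = ((1 - \sum_(j in J) p j) ^+ n)%:E.
Proof.
rewrite unseenE; have [indU _] := iidU.
rewrite (indU _ (fun=> symbols_avoiding J))//.
rewrite (eq_bigr (fun=> (1 - \sum_(j in J) p j)%:E)); last by move=> i _;
    exact: draw_avoid.
rewrite prodEFin big_const_seq count_predT iter_mulr_1 /=.
have -> : size [fset i in iota 0 n]%fset = n.
  by rewrite card_fseq undup_id ?iota_uniq// size_iota.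
by [].
Qed.

Variables (N : R -> {RV P >-> nat}).
Hypothesis poiN : poisson_sizes U N.

Definition poisson_unseen t M (J : {set 'I_M}) : set T :=
  [set w | forall j, j \in J -> occupancy (fun i => U i) (N t w) j w == 0%N].

Lemma poisson_unseenE t M (J : {set 'I_M}) :
  poisson_unseen t J = \bigcup_k (N t @^-1` [set k] `&` unseen k J).
Proof.
apply/seteqP; split => w /=; first by move=> h; exists (N t w).
by move=> [k _ [/= Nk h]]; rewrite /poisson_unseen/= Nk.
Qed.

Lemma measurable_poisson_unseen t M (J : {set 'I_M}) : measurable (poisson_unseen t
    J).
Proof.
rewrite poisson_unseenE; apply: bigcup_measurable => k _; apply: measurableI.
  exact: measurable_funPTI.
exact: measurable_unseen.
Qed.

(** Splitting according to N(t) = k gives the sum of e^{-t} (t (1 - s))^k / k!, that is e^{-t} e^{t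
    (1 - s)}. *)
Lemma prob_poisson_unseen t M (J : {set 'I_M}) : 0 < t ->
  P (poisson_unseen t J) = (expR (- (t * \sum_(j in J) p j)))%:E.
Proof.
move=> t0; have [Nk indN] := poiN t0; rewrite poisson_unseenE.
rewrite measure_semi_bigcup; last 3 first.
- move=> k; apply: measurableI; first exact: measurable_funPTI.
  exact: measurable_unseen.
- by move=> k l _ _ [w [[/= <- _] [/= <- _]]].
- by rewrite -poisson_unseenE; exact: measurable_poisson_unseen.
set s := \sum_(j in J) p j.
transitivity (\sum_(0 <= k <oo) (expR (- t) * exp_coeff (t * (1 - s)) k)%:E)%E.
  apply: eq_eseriesr => k _; 
  have -> : (expR (- t) * exp_coeff (t * (1 - s)) k)%:E =
      (P (N t @^-1` [set k]) * P (unseen k J))%E.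
    rewrite Nk prob_unseen -EFinM /poisson_pmf t0 /exp_coeff/= exprMn; congr EFin.
    by rewrite -/s; ring.
  by apply: indN => //; exact: unseen_sigma_of_seq.
have cvg_exp := is_cvg_series_exp_coeff (t * (1 - s)).
apply: cvg_lim => //.
rewrite (_ : (fun n => _) = EFin \o (fun n => expR (- t) * series (exp_coeff (t *
    (1 - s))) n)); last first.
  by apply/funext => n /=; rewrite sumEFin /series/= mulr_sumr.
have -> : expR (- (t * s)) = expR (- t) * expR (t * (1 - s)).
  by rewrite -expRD; congr expR; ring.
by apply: cvg_comp; first by apply: cvgMr; exact: cvg_exp.
Qed.

End avoidance.

(** * Variances *)

Section real_inequalities.
Variable R : realType.

Lemma subrX_le (x y : R) n : 0 <= y <= x ->
  0 <= x ^+ n.+1 - y ^+ n.+1 <= n.+1%:R * (x - y) * x ^+ n.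
Proof.
move=> /andP[y0 yx]; have x0 : 0 <= x by lra.
elim: n => [|n /andP[h1 h2]]; first by rewrite !expr1 expr0; apply/andP; split; lra.
rewrite (_ : x ^+ n.+2 - y ^+ n.+2 = x * (x ^+ n.+1 - y ^+ n.+1) + (x - y) * y ^+
    n.+1);
  last by rewrite !exprS; ring.
have yn : 0 <= y ^+ n.+1 <= x ^+ n.+1 by rewrite exprn_ge0// lerXn2r.
case/andP: yn => yn0 ynx; rewrite -(natr1 n.+1).
apply/andP; split; first by rewrite addr_ge0 ?mulr_ge0// subr_ge0.
rewrite (_ : _ * x ^+ n.+1 = x * (n.+1%:R * (x - y) * x ^+ n) + (x - y) * x ^+ n.+1);
  last by rewrite exprS; ring.
by rewrite lerD// ler_wpM2l// subr_ge0.
Qed.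

Lemma exprB1_le_expR (x : R) n : 0 <= x <= 1 -> (1 - x) ^+ n <= expR (- (n%:R * x)).
Proof.
move=> /andP[x0 x1]; rewrite -mulrN expRM_natl lerXn2r ?nnegrE ?expR_ge0 ?subr_ge0//.
exact: expR_ge1Dx.
Qed.

(** [subrX_le] produces powers of exponent n - 1; the missing factor is recovered at the price e^x
    <= e. *)
Lemma exprB1_le_expR_shift (x : R) n : 0 <= x <= 1 ->
  (1 - x) ^+ n <= expR 1 * expR (- (n.+1%:R * x)).
Proof.
move=> x01; apply: (le_trans (exprB1_le_expR n x01)).
by rewrite -expRD ler_expR -natr1; case/andP: x01; lra.
Qed.

(** With u = e^{-x} <= 1/(1 + x) <= 1 - x + x^2, the bases differ by at most x^2; [subrX_le] carries
    this over to the powers, and u^n <= e u^{n+1}. *)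
Lemma expR_exprB1_gap (x : R) n : 0 <= x <= 1 ->
  0 <= expR (- (n.+1%:R * x)) - (1 - x) ^+ n.+1 <=
    expR 1 * n.+1%:R * x ^+ 2 * expR (- (n.+1%:R * x)).
Proof.
move=> /andP[x0 x1]; rewrite -mulrN expRM_natl; set u := expR (- x).
have u1 : 1 - x <= u by exact: expR_ge1Dx.
have ux : u - (1 - x) <= x ^+ 2.
  have : u <= (1 + x)^-1.
    by rewrite /u expRN lef_pV2 ?posrE ?expR_gt0 ?expR_ge1Dx//; lra.
  have : (1 + x)^-1 <= 1 - x + x ^+ 2.
    by rewrite -[leLHS]mul1r ler_pdivrMr; [nra|lra].
  lra.
have /andP[-> /= h] := @subrX_le u (1 - x) n ltac:(by rewrite subr_ge0 x1).
apply: (le_trans h).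
have un : u ^+ n <= expR 1 * u ^+ n.+1.
  rewrite exprS mulrA ler_peMl ?exprn_ge0 ?expR_ge0//.
  by rewrite /u -expRD -[leLHS]expR0 ler_expR; lra.
rewrite [leRHS](_ : _ = n.+1%:R * x ^+ 2 * (expR 1 * u ^+ n.+1)); last by ring.
rewrite ler_pM//; last by rewrite ler_wpM2l.
  by rewrite mulr_ge0// subr_ge0.
by rewrite exprn_ge0// expR_ge0.
Qed.

(** This is the Weierstrass product inequality, from which [binomial_q_sub] follows by taking
    powers; the bounds 0 and 1 on the product let the induction go through. *)
Lemma prod_1B_ge (I : Type) (s : seq I) (x : I -> R) : (forall i, 0 <= x i <= 1) ->
  1 - \sum_(i <- s) x i <= \prod_(i <- s) (1 - x i) <= 1 /\ 0 <= \prod_(i <- s) (1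
      - x i).
Proof.
move=> x01; elim: s => [|i s [/andP[h1 h2] h3]].
  by rewrite !big_nil subr0 lexx ler01.
rewrite !big_cons; have /andP[] := x01 i; move: (\sum_(i <- s) _) (\prod_(i <- s)
    _) h1 h2 h3.
by move=> A B *; split; first apply/andP; first split; nra.
Qed.

End real_inequalities.

(** * The truncated variances in both models *)

Section mass_variance.
Variables (R : realType) (p : nat -> R) (a : R -> R).
Hypothesis p_pmf : is_pmf p.
Hypothesis ell_Pi : ext_slow_variation (ell p) a.
Hypothesis a_slow : slowly_varying a.
Hypothesis a_infty : a x @[x --> +oo] --> +oo.

Let p_ge0 j : 0 <= p j. Proof. by case: p_pmf. Qed.
Let p_01 j : 0 <= p j <= 1. Proof. by rewrite p_ge0 pmf_le1. Qed.

Lemma sum_in_le1 N (J : {set 'I_N}) : \sum_(j in J) p j <= 1.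
Proof.
apply: le_trans (pmf_psum_le1 p_pmf N); rewrite [leRHS](bigID (mem J))/= lerDl.
exact: sumr_ge0.
Qed.

Lemma binomial_q_sub n N (J : {set 'I_N}) :
  (1 - \sum_(j in J) p j) ^+ n <= \prod_(j in J) (1 - p j) ^+ n.
Proof.
rewrite prodrXl -!big_enum.
have [/andP[h _] h0] := prod_1B_ge (enum J) (fun j : 'I_N => p_01 j).
rewrite lerXn2r// nnegrE subr_ge0 big_enum; exact: sum_in_le1.
Qed.

Lemma poisson_q_sub t N (J : {set 'I_N}) :
  expR (- (t * \sum_(j in J) p j)) <= \prod_(j in J) expR (- (t * p j)).
Proof. by rewrite -expR_sum sumrN mulr_sumr. Qed.

(** With s = [lambda / t], the bound s^2 / (1 - s) * 6 a(t) is the stated one, which explains 12 = 2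
    * 6 in [var_factor]. The inequality required of [q] is an equality in the Poisson model and (1 -
    x)^n <= e^{-n x} in the other. *)
Lemma mgf_sum_le (t lambda : R) (q : nat -> R) N : 0 < lambda < t ->
  (forall N, \sum_(j < N) envelope (t * p j) <= 6 * a t) ->
  (forall j, q j <= expR (- (t * p j))) ->
  \sum_(j < N) q j * (expR (lambda * p j) - 1 - lambda * p j) <=
  var_factor a t * lambda ^+ 2 / (2 * (1 - lambda / t)).
Proof.
move=> /andP[l0 lt] env qle; have t0 : 0 < t by lra.
set s := lambda / t; have s01 : 0 < s < 1.
  by rewrite /s divr_gt0// ltr_pdivrMr// mul1r.
have lE : lambda = s * t by rewrite /s mulfVK ?gt_eqF.
case/andP: (s01) => s0 s1.
rewrite [leRHS](_ : _ = s ^+ 2 / (1 - s) * (6 * a t)); last first.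
  rewrite /var_factor lE; field; rewrite !gt_eqF ?subr_gt0//.
apply: (@le_trans _ _ (\sum_(j < N) s ^+ 2 / (1 - s) * envelope (t * p j))).
  apply: ler_sum => j _; apply: (le_trans _ (mgf_term_le s01 _)); last first.
    by rewrite mulr_ge0// ltW.
  rewrite lE -mulrA ler_wpM2r// -addrA -opprD subr_ge0; exact: expR_ge1Dx.
by rewrite -mulr_sumr ler_wpM2l ?env// divr_ge0 ?exprn_ge0 ?subr_ge0 ?ltW.
Qed.

(** This is the variance of the truncated Poisson missing mass, whose covariances vanish
    ([poisson_psum_variance]). *)
Definition diag_variance (t : R) N : R :=
  \sum_(j < N) p j ^+ 2 * (expR (- (t * p j)) - expR (- (t * p j)) ^+ 2).

Lemma diag_varianceE t N : 0 < t -> diag_variance t N =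
  (\sum_(j < N) bell (t * p j) - (\sum_(j < N) bell (2 * t * p j)) / 4) / t ^+ 2.
Proof.
move=> t0; rewrite mulr_suml -sumrB mulr_suml; apply: eq_bigr => j _.
have e2 : expR (- (2 * t * p j)) = expR (- (t * p j)) ^+ 2.
  by rewrite -expRM_natl; congr expR; ring.
by rewrite /bell e2; field; rewrite gt_eqF.
Qed.

(* The error term delta absorbs the covariances of the binomial model. *)
Lemma diag_variance_asymp (e : R) : 0 < e -> \forall t \near +oo,
  forall (V delta : R),
    (forall N, `|V - diag_variance t N| <= 2 * pmf_rest p N + delta) ->
    `|V - 3 / 4 * (a t / t ^+ 2)| <= e * (a t / t ^+ 2) + delta.
Proof.
(* The cap 1 gives a(2t) <= 2 a(t). The errors of the two sums and of the ratio a(2t)/a(t) then add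
   up to at most 7/4 e' a(t) <= 7/16 e a(t). *)
move=> e0; pose e' := Num.min 1 (e / 4).
have e'0 : 0 < e' by rewrite lt_min ltr01 divr_gt0.
have e'1 : e' <= 1 by rewrite ge_min lexx.
have e'e : e' <= e / 4 by rewrite ge_min lexx orbT.
have [T [T1 HT]] := near_pinfty_ex (bell_sum_asymp p_pmf ell_Pi a_slow a_infty e'0).
have /cvgrPdist_le/(_ _ e'0) lim_a := a_slow (ltac:(lra) : 0 < 2 :> R).
near=> t.
have Tt : T <= t by near: t; apply: nbhs_pinfty_ge; exact: num_real.
have t0 : 0 < t by lra.
have at0 : 0 < a t by near: t; exact: near_aux_gt.
have a2 : `|1 - a (t * 2) / a t| <= e' by near: t.
move=> V delta HV; set A := a t / t ^+ 2.
have A0 : 0 < A by rewrite divr_gt0// exprn_gt0.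
have eA : 0 < e / 32 * A by rewrite mulr_gt0//; lra.
have S1 := HT _ Tt; have S2 := HT (2 * t) ltac:(lra).
have /filter_ex[N [[h1 h2] h3]] : \forall N \near \oo,
    (`|\sum_(j < N) bell (t * p j) - a t| <= e' * a t /\
    `|\sum_(j < N) bell (2 * t * p j) - a (2 * t)| <= e' * a (2 * t)) /\
    pmf_rest p N <= e / 32 * A.
  apply: filterI; first exact: filterI.
  exact: pmf_tail.
have := HV N; rewrite diag_varianceE//.
have a2' : `|a (2 * t) - a t| <= e' * a t.
  rewrite -(ler_pM2r at0) -[X in _ * X <= _](ger0_norm (ltW at0)) -normrM in a2.
  by move: a2; rewrite mulrBl mulfVK ?gt_eqF// mul1r distrC [t * 2]mulrC.
have : `|\sum_(j < N) bell (t * p j) - (\sum_(j < N) bell (2 * t * p j)) / 4 - 3 /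
    4 * a t|
    <= 7 / 16 * e * a t.
  have e2 : e' * a (2 * t) <= 2 * e' * a t.
    by move: a2'; rewrite ler_norml; nra.
  have e1 : e' * a t <= e / 4 * a t by rewrite ler_pM2r.
  move: h1 h2 a2'; rewrite !ler_norml; lra.
move: (\sum_(j < N) bell (2 * t * p j)) (\sum_(j < N) bell (t * p j)) => B2 B1 hB.
have t20 : 0 < t ^+ 2 by rewrite exprn_gt0.
have : `|(B1 - B2 / 4) / t ^+ 2 - 3 / 4 * A| <= 7 / 16 * e * A.
  rewrite /A !mulrA -mulrBl normrM [X in _ * X]ger0_norm ?invr_ge0 ?(ltW t20)//.
  by rewrite ler_pM2r// invr_gt0.
move: (_ / t ^+ 2) => D; rewrite !ler_norml => *;
    have : 0 < e * A by rewrite mulr_gt0.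
lra.
Unshelve. all: by end_near. Qed.

Lemma pair_massE N (i j : 'I_N) : pair_mass p i j = if i == j then p i else p i + p
    j.
Proof.
rewrite /pair_mass; case: eqVneq => [<-|ij].
  by rewrite finset.setUid big_set1.
by rewrite big_setU1 ?inE//= big_set1.
Qed.

Lemma poisson_psum_variance t N :
  psum_variance p (fun x => expR (- (t * x))) N = diag_variance t N.
Proof.
apply: eq_bigr => i _; rewrite (bigD1 i)//= big1 ?addr0 => [|j ji].
  by rewrite pair_massE eqxx; ring.
by rewrite pair_massE eq_sym (negbTE ji) [t * (_ + _)]mulrDr opprD expRD subrr mulr0.
Qed.

(** On the diagonal (1 - p_i)^n is replaced by e^{-n p_i}; off it, 1 - p_i - p_j and (1 - p_i)(1 -
    p_j) differ by p_i p_j, and [subrX_le] bounds the covariance. The sums of p_j^k e^{-n p_j} for k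
    = 4 and k = 2 give 720 = 5! * 6 and 1296 = (3! * 6)^2. *)
Lemma binomial_psum_variance (n N : nat) : (0 < n)%N ->
  (forall N, \sum_(j < N) envelope (n%:R * p j) <= 6 * a n%:R) ->
  `|psum_variance p (fun x => (1 - x) ^+ n) N - diag_variance n%:R N| <=
    (720 * expR 1 * a n%:R + 1296 * expR 1 ^+ 2 * a n%:R ^+ 2) / n%:R ^+ 3.
Proof.
move=> n0 env; have n0' : 0 < n%:R :> R by rewrite ltr0n.
set E := expR 1; have E0 : 0 <= E := expR_ge0 1.
pose ex j := expR (- (n%:R * p j)).
have ex0 j : 0 <= ex j by exact: expR_ge0.
have np j : 0 <= n%:R * p j by rewrite mulr_ge0.
have moment (k : nat) : (1 < k)%N ->
    \sum_(j < N) p j ^+ k * ex j <= k.+1`!%:R * 6 * a n%:R / n%:R ^+ k.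
  move=> k1; rewrite ler_pdivlMr ?exprn_gt0// mulr_suml -[leRHS]mulrA.
  apply: (@le_trans _ _ (\sum_(j < N) k.+1`!%:R * envelope (n%:R * p j))).
    apply: ler_sum => j _; apply: le_trans (powM_expRN_le_envelope k1 (np j)).
    by rewrite exprMn le_eqVlt; apply/orP; left; apply/eqP; rewrite /ex; ring.
  by rewrite -mulr_sumr ler_wpM2l.
pose qn (x : R) := (1 - x) ^+ n.
have qn0 j : 0 <= qn (p j) by rewrite exprn_ge0// subr_ge0; case/andP: (p_01 j).
have qn_ex j : 0 <= ex j - qn (p j) <= E * n%:R * p j ^+ 2 * ex j.
  by have := expR_exprB1_gap n.-1 (p_01 j); rewrite prednK.
have ex1 j : ex j <= 1 by exact: expRN_le1.
have diag : `|\sum_(i < N) p i ^+ 2 * (qn (p i) - qn (p i) ^+ 2) - diag_variance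
    n%:R N|
    <= E * n%:R * \sum_(i < N) p i ^+ 4 * ex i.
  rewrite -sumrB (le_trans (ler_norm_sum _ _ _))// mulr_sumr.
  apply: ler_sum => i _; rewrite -mulrBr normrM ger0_norm ?exprn_ge0//.
  rewrite [leRHS](_ : _ = p i ^+ 2 * (E * n%:R * p i ^+ 2 * ex i)); last by ring.
  rewrite ler_wpM2l ?exprn_ge0//; have /andP[h1 h2] := qn_ex i.
  apply: le_trans h2; rewrite -/(ex i).
  (* With 0 <= x <= y <= 1, the difference of x - x^2 and y - y^2 is (x - y)(1 - x - y), at most y -
     x in absolute value. *)
  move: h1 (qn0 i) (ex1 i); move: (qn _) (ex i) => x y h1 x0 y1.
  by rewrite ler_norml; apply/andP; split; nra.
have qn_shift j : (1 - p j) ^+ n.-1 <= E * ex j.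
  by have := exprB1_le_expR_shift n.-1 (p_01 j); rewrite prednK.
have off (i j : 'I_N) : i != j ->
    `|p i * p j * (qn (pair_mass p i j) - qn (p i) * qn (p j))| <=
    n%:R * E ^+ 2 * ((p i ^+ 2 * ex i) * (p j ^+ 2 * ex j)).
  move=> ij; have pij := sum_in_le1 [set i; j]%SET.
  rewrite -/(pair_mass p i j) in pij; move: pij;
      rewrite pair_massE (negbTE ij) => pij.
  rewrite normrM ger0_norm ?mulr_ge0//.
  rewrite [leRHS](_ : _ = p i * p j * (n%:R * (p i * p j) * ((E * ex i) * (E * ex
      j)))); last by ring.
  rewrite ler_wpM2l ?mulr_ge0// distrC /qn -exprMn.
  have := @subrX_le R ((1 - p i) * (1 - p j)) (1 - (p i + p j)) n.-1.
  rewrite prednK// => /(_ _)/andP[|h1 h2].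
    by rewrite subr_ge0 pij/=; have := mulr_ge0 (p_ge0 i) (p_ge0 j); lra.
  rewrite ger0_norm//; apply: (le_trans h2); apply: ler_pM.
  - by rewrite mulr_ge0//; have := mulr_ge0 (p_ge0 i) (p_ge0 j); lra.
  - by rewrite exprn_ge0// mulr_ge0// subr_ge0;
      [case/andP: (p_01 i)|case/andP: (p_01 j)].
  - by rewrite ler_pM2l//; lra.
  - by rewrite exprMn ler_pM// exprn_ge0// subr_ge0;
      [case/andP: (p_01 i)|case/andP: (p_01 j)].
have E2 : psum_variance p qn N = \sum_(i < N) p i ^+ 2 * (qn (p i) - qn (p i) ^+ 2) +
   \sum_(i < N) \sum_(j < N | j != i) p i * p j * (qn (pair_mass p i j) - qn (p i)
       * qn (p j)).
  rewrite -big_split/=; apply: eq_bigr => i _; rewrite (bigD1 i)//=; congr (_ + _).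
  by rewrite pair_massE eqxx -!expr2.
have offsum : `|\sum_(i < N) \sum_(j < N | j != i)
      p i * p j * (qn (pair_mass p i j) - qn (p i) * qn (p j))| <=
    n%:R * E ^+ 2 * (\sum_(i < N) p i ^+ 2 * ex i) ^+ 2.
  rewrite (le_trans (ler_norm_sum _ _ _))// [(\sum_(i < N) p i ^+ 2 * ex i) ^+
      2]expr2 big_distrlr/= mulr_sumr.
  apply: ler_sum => i _; rewrite (le_trans (ler_norm_sum _ _ _))// mulr_sumr.
  (* The nonnegative diagonal term is restored to complete the square of the sum. *)
  rewrite [leRHS](bigD1 i)//= ler_wpDl//.
    by rewrite !mulr_ge0 ?exprn_ge0.
  by apply: ler_sum => j ji; apply: off; rewrite eq_sym.
rewrite -/qn E2 addrAC (le_trans (ler_normD _ _))//.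
rewrite mulrDl lerD//.
  apply: (le_trans diag); rewrite [leRHS](_ : _ =
      E * n%:R * (5`!%:R * 6 * a n%:R / n%:R ^+ 4)); last first.
    by rewrite (_ : 5`! = 120)%N//; field; rewrite gt_eqF.
  by rewrite ler_wpM2l ?moment ?mulr_ge0.
apply: (le_trans offsum); rewrite [leRHS](_ : _ =
    n%:R * E ^+ 2 * (3`!%:R * 6 * a n%:R / n%:R ^+ 2) ^+ 2); last first.
  by rewrite (_ : 3`! = 6)%N//; field; rewrite gt_eqF.
rewrite ler_wpM2l ?mulr_ge0 ?exprn_ge0// lerXn2r ?nnegrE ?moment//.
  by rewrite sumr_ge0// => j _; rewrite mulr_ge0// exprn_ge0.
rewrite divr_ge0 ?exprn_ge0 ?mulr_ge0//; have := env 0; rewrite big_ord0; lra.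
Qed.

End mass_variance.

(** * The missing mass *)

Section missing_mass.

(** The filter is arbitrary so as to serve both n and t tending to infinity. *)
Lemma equiv_order_of_approx (R : realType) (I : Type) (F : set_system I)
    (FF : Filter F) (V a t : I -> R) :
  (\forall x \near F, 0 < a x /\ 0 < t x) ->
  (forall e, 0 < e -> \forall x \near F,
    `|V x - 3 / 4 * (a x / t x ^+ 2)| <= e * (a x / t x ^+ 2)) ->
  asymp_equiv F V (fun x => 3 * a x / (4 * t x ^+ 2)) /\
  asymp_order F (fun x => 12 * a x / t x ^+ 2) V.
Proof.
move=> at0 HV.
have A0 : \forall x \near F, 0 < a x / t x ^+ 2.
  by apply: filterS at0 => x [a0 t0]; rewrite divr_gt0// exprn_gt0.
have E x : 3 * a x / (4 * t x ^+ 2) = 3 / 4 * (a x / t x ^+ 2) by rewrite invfM;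
    move: (t x ^+ 2)^-1 => z; field.
split.
  apply/cvgrPdist_le => e e0.
  have e30 : 0 < 3 / 4 * e by lra.
  apply: filterS2 A0 (HV _ e30) => x A0 h /=.
  rewrite E; move: (a x / _) A0 h => A A0 h.
  have A30 : 0 < 3 / 4 * A by lra.
  rewrite -(ler_pM2r A30) -[X in _ * X <= _](ger0_norm (ltW A30)) -normrM.
  by rewrite mulrBl mulfVK ?gt_eqF// mul1r distrC; lra.
(* Precision 3/8 places V between 3/8 and 9/8 times a/t^2, so that 12 a/t^2 is between 32/3 and 32
   times V. *)
exists 8, 32; split=> //; have e0 : 0 < 3 / 8 :> R by lra.
apply: filterS2 A0 (HV _ e0) => x A0 h /=.
rewrite -[12 * _ / _]mulrA; move: (a x / _) A0 h => A A0;
    rewrite ler_norml => /andP[h1 h2].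
have V0 : 0 < V x by lra.
by rewrite ler_pdivrMr// ler_pdivlMr//; lra.
Qed.

Lemma near_pinfty_nat (R : realType) (Q : R -> Prop) :
  (\forall t \near +oo, Q t) -> \forall n \near \oo, Q n%:R.
Proof.
move=> /near_pinfty_ex[T [_ HT]]; near=> n; apply: HT.
by near: n; exact: nbhs_infty_ger.
Unshelve. all: by end_near. Qed.

Variables (R : realType) (p : nat -> R) (a : R -> R).
Hypothesis p_pmf : is_pmf p.
Hypothesis ell_Pi : ext_slow_variation (ell p) a.
Hypothesis a_slow : slowly_varying a.
Hypothesis a_infty : a x @[x --> +oo] --> +oo.

Let p_ge0 j : 0 <= p j. Proof. by case: p_pmf. Qed.
Let p_01 j : 0 <= p j <= 1. Proof. by rewrite p_ge0 pmf_le1. Qed.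

(** * Samples of fixed size *)

Section binomial.
Context d (T : measurableType d) (P : probability T R) (U : nat -> {RV P >-> nat}).
Hypothesis iidU : iid_sample p U.

Lemma missing_massE n : missing_mass p U n =
  event_mass p (fun j w => occupancy (fun i => U i) n j w == 0%N).
Proof. by []. Qed.

Lemma measurable_unseen1 n j :
  measurable [set w | occupancy (fun i => U i) n j w == 0%N].
Proof.
rewrite (_ : [set w | _] = unseen U n [set @ord_max j]%SET).
  exact: measurable_unseen.
apply/seteqP; split => w /= h; first by move=> k; rewrite inE => /eqP ->.
by apply: (h ord_max); rewrite inE.
Qed.

Lemma missing_mass_log_mgf (n : nat) (lambda : R) : 0 < lambda < n%:R ->
  (forall N, \sum_(j < N) envelope (n%:R * p j) <= 6 * a n%:R) ->
  (log_mgf P (missing_mass p U n) lambda <= (var_factor a n%:R * lambda ^+ 2 /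
     (2 * (1 - lambda / n%:R)))%:E)%E.
Proof.
move=> ln env; rewrite missing_massE.
apply: (log_mgf_event_mass p_pmf (measurable_unseen1 n) (q := fun x => (1 - x) ^+
    n)).
- by move=> N J; exact: prob_unseen.
- by case/andP: ln.
- by move=> j; rewrite exprn_ge0// subr_ge0; case/andP: (p_01 j).
- by move=> N J; exact: binomial_q_sub.
- move=> N; apply: (mgf_sum_le p_pmf (q := fun j => (1 - p j) ^+ n) _ ln env).
  by move=> j; exact: exprB1_le_expR.
Qed.

Lemma missing_mass_variance (e : R) : 0 < e -> \forall n \near \oo,
  `|fine 'V_P[missing_mass p U n] - 3 / 4 * (a n%:R / n%:R ^+ 2)| <=
    e * (a n%:R / n%:R ^+ 2).
Proof.
move=> e0; have e20 : 0 < e / 2 by lra.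
set E : R := expR 1; have E0 : 0 <= E := expR_ge0 1.
(* As a(n) > 1, the linear term of delta is bounded by a quadratic one and delta <= K a(n)^2 / n^3;
   then a(n) <= e/(2K) n makes it at most half of the allowed error. *)
pose K := 720 * E + 1296 * E ^+ 2 + 1.
have EE : 0 <= E ^+ 2 by rewrite exprn_ge0.
have K0 : 0 < K by rewrite /K; lra.
have eK : 0 < e / 2 / K by rewrite divr_gt0.
have h1 := near_pinfty_nat (diag_variance_asymp p_pmf ell_Pi a_slow a_infty e20).
have h2 := near_pinfty_nat (aux_over_id p_pmf ell_Pi a_slow a_infty eK).
have h3 := near_pinfty_nat (near_aux_gt a_infty 1).
have [S [S1 HS]] := envelope_sum_le p_pmf ell_Pi a_slow a_infty.
have h4 : \forall n \near \oo, [/\ (0 < n)%N, S <= n%:R, 1 < a n%:R &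
    a n%:R <= e / 2 / K * n%:R].
  near=> n; split; [|near: n; exact: nbhs_infty_ger|by near: n|by near: n].
  by near: n; exact: nbhs_infty_ge.
apply: filterS2 h1 h4 => n diag [n0 Sn a1 an].
have n0' : 0 < n%:R :> R by rewrite ltr0n.
have [_ env] := HS _ Sn.
pose delta := (720 * E * a n%:R + 1296 * E ^+ 2 * a n%:R ^+ 2) / n%:R ^+ 3.
have delta_le : delta <= e / 2 * (a n%:R / n%:R ^+ 2).
  rewrite /delta ler_pdivrMr ?exprn_gt0//.
  rewrite [leRHS](_ : _ = a n%:R * (K * (e / 2 / K * n%:R))); last first.
    by field; rewrite !gt_eqF.
  apply: (@le_trans _ _ (a n%:R * (K * a n%:R))).
    rewrite /K; move: (a n%:R) (E ^+ 2) a1 EE => x F x1 F0.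
    have : 0 <= E * (x * (x - 1)) by rewrite !mulr_ge0//; lra.
    by nra.
  by rewrite ler_pM2l ?ler_pM2l//; lra.
have := diag (fine 'V_P[missing_mass p U n]) delta.
move=> /(_ _)/le_trans; apply; last by lra.
move=> N; have := @event_mass_variance_approx _ _ _ P p _ (fun x => (1 - x) ^+ n)
  p_pmf (measurable_unseen1 n) (fun N J => prob_unseen iidU n J) N.
have := binomial_psum_variance p_pmf N n0 env; rewrite -missing_massE -/E -/delta.
move: (fine _) (psum_variance _ _ _) (diag_variance _ _ _) => x y z.
by rewrite !ler_norml; lra.
Unshelve. all: by end_near. Qed.

End binomial.

(** * Samples of Poisson size *)

Section poisson.
Context d (T : measurableType d) (P : probability T R) (U : nat -> {RV P >-> nat})
  (N : R -> {RV P >-> nat}).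
Hypothesis iidU : iid_sample p U.
Hypothesis poiN : poisson_sizes U N.

Lemma poisson_missing_massE t : poisson_missing_mass p U N t =
  event_mass p (fun j w => occupancy (fun i => U i) (N t w) j w == 0%N).
Proof. by []. Qed.

Lemma measurable_poisson_unseen1 t j :
  measurable [set w | occupancy (fun i => U i) (N t w) j w == 0%N].
Proof.
rewrite (_ : [set w | _] = poisson_unseen U N t [set @ord_max j]%SET).
  exact: measurable_poisson_unseen.
apply/seteqP; split => w /= h; first by move=> k; rewrite inE => /eqP ->.
by apply: (h ord_max); rewrite inE.
Qed.

Lemma poisson_missing_mass_log_mgf (t lambda : R) : 0 < lambda < t ->
  (forall M, \sum_(j < M) envelope (t * p j) <= 6 * a t) ->
  (log_mgf P (poisson_missing_mass p U N t) lambda <=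
    (var_factor a t * lambda ^+ 2 / (2 * (1 - lambda / t)))%:E)%E.
Proof.
move=> lt env; rewrite poisson_missing_massE.
have t0 : 0 < t by lra.
apply: (log_mgf_event_mass p_pmf (measurable_poisson_unseen1 t)
  (q := fun x => expR (- (t * x)))).
- by move=> M J; exact: prob_poisson_unseen.
- by case/andP: lt.
- by move=> j; exact: expR_ge0.
- by move=> M J; exact: poisson_q_sub.
- by move=> M; apply: (mgf_sum_le p_pmf (q := fun j => expR (- (t * p j))) _ lt env).
Qed.

Lemma poisson_missing_mass_variance (e : R) : 0 < e -> \forall t \near +oo,
  `|fine 'V_P[poisson_missing_mass p U N t] - 3 / 4 * (a t / t ^+ 2)| <=
    e * (a t / t ^+ 2).
Proof.
move=> e0; have h1 := diag_variance_asymp p_pmf ell_Pi a_slow a_infty e0.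
apply: filterS2 (nbhs_pinfty_gt (num_real (0 : R))) h1 => t t0 diag.
(* The truncated variance is exactly [diag_variance], so delta = 0. *)
rewrite -[leRHS]addr0; apply: diag => // M; rewrite addr0.
rewrite -poisson_psum_variance.
exact: (@event_mass_variance_approx _ _ _ P p _ (fun x => expR (- (t * x)))
  p_pmf (measurable_poisson_unseen1 t) (fun M J => prob_poisson_unseen iidU poiN J
      t0)).
Qed.

End poisson.

End missing_mass.

Unset Implicit Arguments.

Theorem theorem4p6 (R : realType) (p : nat -> R) (a : R -> R)
    (p_pmf : is_pmf p)
    (ell_Pi : ext_slow_variation (ell p) a)
    (a_slow : slowly_varying a)
    (a_infty : a x @[x --> +oo] --> +oo) :
  [/\ (forall (d : measure_display) (T : measurableType d)
         (P : probability T R) (U : nat -> {RV P >-> nat}),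
         iid_sample p U ->
         let V := fun n : nat => fine 'V_P[missing_mass p U n] in
         asymp_equiv \oo V (fun n : nat => 3 * a n%:R / (4 * n%:R ^+ 2)) /\
         asymp_order \oo (fun n : nat => var_factor a n%:R) V),
      (exists n0 : nat,
         forall (d : measure_display) (T : measurableType d)
           (P : probability T R) (U : nat -> {RV P >-> nat}),
         iid_sample p U ->
         forall (n : nat) (lambda : R), (n0 < n)%N -> 0 < lambda < n%:R ->
         (log_mgf P (missing_mass p U n) lambda <=
          (var_factor a n%:R * lambda ^+ 2 /
             (2 * (1 - lambda / n%:R)))%:E)%E),
      (forall (d : measure_display) (T : measurableType d)
         (P : probability T R) (U : nat -> {RV P >-> nat})
         (N : R -> {RV P >-> nat}),
         iid_sample p U -> poisson_sizes U N ->
         let V := fun t : R => fine 'V_P[poisson_missing_mass p U N t] in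
         asymp_equiv +oo V (fun t : R => 3 * a t / (4 * t ^+ 2)) /\
         asymp_order +oo (var_factor a) V)
    & (exists t0 : R,
         forall (d : measure_display) (T : measurableType d)
           (P : probability T R) (U : nat -> {RV P >-> nat})
           (N : R -> {RV P >-> nat}),
         iid_sample p U -> poisson_sizes U N ->
         forall t lambda : R, t0 < t -> 0 < lambda < t ->
         (log_mgf P (poisson_missing_mass p U N t) lambda <=
          (var_factor a t * lambda ^+ 2 / (2 * (1 - lambda / t)))%:E)%E)].
Proof.
(* [S] depends on [p] and [a] only, so one threshold serves every probability space, every [lambda]
   and both models. *)
have [S [S1 HS]] := envelope_sum_le p_pmf ell_Pi a_slow a_infty.
have at0 : \forall t \near +oo, 0 < a t /\ 0 < t.
  by apply: filterI; [exact: near_aux_gt|apply: nbhs_pinfty_gt; exact: num_real].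
split.
- move=> d T P U iidU V; apply: equiv_order_of_approx.
    exact: (near_pinfty_nat at0).
  by move=> e e0; exact: missing_mass_variance.
- exists (Num.truncn S).+1 => d T P U iidU n lambda n0n ln.
  apply: missing_mass_log_mgf => // N.
  have Sn : S <= n%:R.
    by rewrite ltW// (lt_le_trans (truncnS_gt _))// ler_nat ltnW.
  by case: (HS _ Sn).
- move=> d T P U N iidU poiN V; apply: (@equiv_order_of_approx _ _ _ _ V a id) => //.
  by move=> e e0; exact: poisson_missing_mass_variance.
- exists S => d T P U N iidU poiN t lambda St lt.
  by apply: poisson_missing_mass_log_mgf => // M; case: (HS _ (ltW St)).
Qed.
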